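(* Let $E\subseteq\mathbb{R}^d$ be a bounded measurable set and let $h\in P_E$ be such that $\hat h$ is continuous. Then there does not exist a countable family $\Lambda=\{\lambda_k\}_{k\in K}\subseteq\mathbb{R}^d$ such that $\{h(\cdot-\lambda_k)\}_{k\in K}$ is a frame of $P_E$.
   Context: The Fourier transform is $\hat f(\omega)=\int_{\mathbb{R}^d}f(x)e^{-2\pi i\omega\cdot x}\,dx$, extended to $L^2(\mathbb{R}^d)$. $P_E=\{f\in L^2(\mathbb{R}^d):\operatorname{supp}\hat f\subseteq E\}$, where the support is understood up to null sets, i.e. $f\in P_E$ means $\hat f=0$ a.e. outside $E$; it is a Hilbert space with the $L^2(\mathbb{R}^d)$ norm. ''$\hat h$ is continuous'' means that $\hat h$ has a representative that is continuous on $\mathbb{R}^d$. A sequence $\{\psi_k\}_{k\in K}$ in a separable Hilbert space $\mathcal{H}$ is a frame for $\mathcal{H}$ if there are constants $A,B>0$ with $A\|f\|^2\le\sum_k|\langle f,\psi_k\rangle|^2\le B\|f\|^2$ for all $f\in\mathcal{H}$.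
   Formalization: The formal theorem additionally assumes that d ≥ 1 and that E has positive measure; if E is null then P_E = {0} and any family is trivially a frame, and for d = 0 the claim fails for h constant, so the statement as written is false there. *)

(* Defs.v *)
From HB Require Import structures.
From mathcomp Require Import all_boot all_order all_algebra.
From mathcomp Require Import all_classical all_reals all_analysis.
From mathcomp Require Export complex.

Set Implicit Arguments.
Unset Strict Implicit.
Unset Printing Implicit Defensive.

Import Order.TTheory GRing.Theory Num.Theory.
Import numFieldNormedType.Exports.

Local Open Scope classical_set_scope.
Local Open Scope ring_scope.
Local Open Scope complex_scope.

Definition rV_display : measure_display -> measure_display.
Proof. exact. Qed.

(* Product sigma-algebra: on 'rV[R]_n it is the Borel sigma-algebra of R^n. *)
Section rV_measurable.
Context {d : measure_display} {T : measurableType d} (n : nat).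

Let coord : 'I_n -> 'rV[T]_n -> T := fun i x => x ord0 i.

Let rV_set0 : g_sigma_preimage coord set0.
Proof. exact: sigma_algebra0. Qed.

Let rV_setC A : g_sigma_preimage coord A -> g_sigma_preimage coord (~` A).
Proof. exact: sigma_algebraC. Qed.

Let rV_bigcup (F : _^nat) : (forall i, g_sigma_preimage coord (F i)) ->
  g_sigma_preimage coord (\bigcup_i (F i)).
Proof. exact: sigma_algebra_bigcup. Qed.

HB.instance Definition _ := @isMeasurable.Build (rV_display d)
  'rV[T]_n (g_sigma_preimage coord) rV_set0 rV_setC rV_bigcup.

End rV_measurable.


Section rV_measurable_fun.
Context {d d' : measure_display} {S : measurableType d} {T : measurableType d'}.

Lemma measurable_rV_coord n (i : 'I_n) :
  measurable_fun [set: 'rV[T]_n] (fun x => x ord0 i).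
Proof.
move=> _ Y mY; rewrite setTI; apply: sub_sigma_algebra => /=.
rewrite -bigcup_seq/=; exists i => /=; first by rewrite mem_index_enum.
by exists Y => //; rewrite setTI.
Qed.

Lemma measurable_fun_rV n (f : S -> 'rV[T]_n) :
  (forall i, measurable_fun [set: S] (fun x => f x ord0 i)) ->
  measurable_fun [set: S] f.
Proof.
move=> mf; apply: (@measurability _ _ _ _ _ _ (\big[setU/set0]_(i < n)
    preimage_set_system setT (fun x : 'rV[T]_n => x ord0 i) measurable)) => //.
move=> _ [B GB <-]; move: GB; rewrite -bigcup_seq => -[i /= _ [A mA <-]].
by have := mf i measurableT A mA; rewrite !setTI.
Qed.

End rV_measurable_fun.

Section lebesgue_rV.
Context {R : realType}.

Definition rV_cons n (p : measurableTypeR R * 'rV[R]_n) : 'rV[R]_n.+1 :=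
  \row_i (if unlift ord0 i is Some j then p.2 ord0 j else p.1).

Definition rV_uncons n (x : 'rV[R]_n.+1) : measurableTypeR R * 'rV[R]_n :=
  (x ord0 ord0, \row_j x ord0 (lift ord0 j)).

Lemma rV_consK n : cancel (@rV_cons n) (@rV_uncons n).
Proof.
move=> [a x]; rewrite /rV_uncons /rV_cons mxE unlift_none /=; congr pair.
by apply/rowP => j; rewrite !mxE liftK.
Qed.

Lemma rV_unconsK n : cancel (@rV_uncons n) (@rV_cons n).
Proof.
move=> x; apply/rowP => i; rewrite mxE.
by case: unliftP => [j|] -> /=; rewrite ?mxE.
Qed.

Lemma measurable_rV_cons n : measurable_fun [set: _] (@rV_cons n).
Proof.
apply: measurable_fun_rV => i; rewrite /rV_cons.
case: (unliftP ord0 i) => [j ij|i0].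
- apply: (eq_measurable_fun ((fun x : 'rV[R]_n => x ord0 j) \o snd)).
    by move=> x _ /=; rewrite mxE ij liftK.
  apply: measurableT_comp; first exact: measurable_rV_coord.
  exact: measurable_snd.
- apply: (eq_measurable_fun fst); last exact: measurable_fst.
  by move=> x _; rewrite mxE i0 unlift_none.
Qed.

Lemma measurable_rV_uncons n : measurable_fun [set: _] (@rV_uncons n).
Proof.
apply: (@measurable_fun_pair _ _ _ _ _ _
  (fun x : 'rV[R]_n.+1 => x ord0 ord0 : measurableTypeR R)
  (fun x : 'rV[R]_n.+1 => \row_j x ord0 (lift ord0 j))).
  exact: (@measurable_rV_coord _ R).
apply: measurable_fun_rV => j.
apply: (eq_measurable_fun (fun x : 'rV[R]_n.+1 => x ord0 (lift ord0 j))).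
  by move=> x _; rewrite mxE.
exact: measurable_rV_coord.
Qed.

Section lebesgue_rV_succ.
Variables (n : nat) (m : {sigma_finite_measure set 'rV[R]_n -> \bar R}).

Definition lebesgue_rV_succ : set 'rV[R]_n.+1 -> \bar R :=
  pushforward (lebesgue_measure \x m)%E (@rV_cons n).

Let lebesgue_rV_succ0 : lebesgue_rV_succ set0 = 0%E.
Proof. by rewrite /lebesgue_rV_succ /pushforward preimage_set0 measure0. Qed.

Let lebesgue_rV_succ_ge0 A : (0 <= lebesgue_rV_succ A)%E.
Proof. by rewrite /lebesgue_rV_succ /pushforward; exact: measure_ge0. Qed.

Let lebesgue_rV_succ_sigma_additive : semi_sigma_additive lebesgue_rV_succ.
Proof.
have mc A : measurable A -> measurable (@rV_cons n @^-1` A).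
  by move=> mA; rewrite -[X in measurable X]setTI; exact: measurable_rV_cons.
move=> F mF tF mUF; rewrite /lebesgue_rV_succ /pushforward preimage_bigcup.
apply: measure_semi_sigma_additive.
- by move=> k; exact: mc.
- apply/trivIsetP => i j _ _ ij; rewrite -preimage_setI.
  by move/trivIsetP : tF => /(_ _ _ I I ij) ->; rewrite preimage_set0.
- by rewrite -preimage_bigcup; exact: mc.
Qed.

HB.instance Definition _ := isMeasure.Build _ _ _ lebesgue_rV_succ
  lebesgue_rV_succ0 lebesgue_rV_succ_ge0 lebesgue_rV_succ_sigma_additive.

Let lebesgue_rV_succ_sigma_finite : sigma_finite setT lebesgue_rV_succ.
Proof.
have /sigma_finiteP[F [TF ndF Foo]] :=
  sigma_finiteT (@lebesgue_measure R : {sigma_finite_measure set _ -> \bar R}).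
have /sigma_finiteP[G [TG ndG Goo]] := sigma_finiteT m.
exists (fun k => @rV_uncons n @^-1` (F k `*` G k)).
  apply/esym; rewrite -subTset => x _.
  have [i _ Fi] : (\bigcup_i F i) (rV_uncons x).1 by rewrite -TF.
  have [j _ Gj] : (\bigcup_i G i) (rV_uncons x).2 by rewrite -TG.
  exists (maxn i j) => //; split.
    by move: Fi; exact/subsetPset/ndF/leq_maxl.
  by move: Gj; exact/subsetPset/ndG/leq_maxr.
move=> k; have [mF Fk] := Foo k; have [mG Gk] := Goo k; split.
  rewrite -[X in measurable X]setTI; apply: measurable_rV_uncons => //.
  exact: measurableX.
rewrite /lebesgue_rV_succ /pushforward -comp_preimage.
rewrite (_ : _ \o _ = id); last by apply/funext => x /=; rewrite rV_consK.
by rewrite preimage_id product_measure1E// lte_mul_pinfty// ge0_fin_numE.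
Qed.

HB.instance Definition _ := @Measure_isSigmaFinite.Build _ _ _
  lebesgue_rV_succ lebesgue_rV_succ_sigma_finite.

End lebesgue_rV_succ.

(* Lebesgue measure on R^n, as the n-fold product of lebesgue_measure. *)
Fixpoint lebesgue_rV (n : nat) : {sigma_finite_measure set 'rV[R]_n -> \bar R} :=
  match n with
  | 0 => \d_(0 : 'rV[R]_0)
  | n'.+1 => lebesgue_rV_succ (lebesgue_rV n')
  end.

Lemma lebesgue_rV_rectangle n (A : 'I_n -> set (measurableTypeR R)) :
  (forall i, measurable (A i)) ->
  lebesgue_rV n [set x | forall i, A i (x ord0 i)] =
  (\prod_(i < n) lebesgue_measure (A i))%E.
Proof.
elim: n A => [|n ih] A mA.
  rewrite big_ord0 /= diracE mem_set//=.
  by case.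
rewrite big_ord_recl -(ih (fun i => A (lift ord0 i)))//.
have mA' : measurable [set x : 'rV[R]_n | forall i, A (lift ord0 i) (x ord0 i)].
  rewrite (_ : [set _ | _] = \bigcap_(i in [set: 'I_n])
      ((fun x : 'rV[R]_n => x ord0 i) @^-1` A (lift ord0 i))); last first.
    by apply/seteqP; split=> x /= Ax i => [_|]; exact: Ax.
  apply: fin_bigcap_measurable => // i _; rewrite -[X in measurable X]setTI.
  exact: (@measurable_rV_coord _ R n i measurableT _ (mA _)).
rewrite -product_measure1E//=.
rewrite /lebesgue_rV_succ /pushforward.
congr (_ \x _)%E; apply/seteqP; split=> -[a x] /=.
  move=> Ax; split; first by have := Ax ord0; rewrite mxE unlift_none.
  by move=> i; have := Ax (lift ord0 i); rewrite mxE liftK.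
by move=> [Aa Ax] i; rewrite mxE; case: unliftP => [j|] ->.
Qed.

End lebesgue_rV.

Definition lebesgue_measurable {R : realType} {d : nat} (E : set 'rV[R]_d) :=
  exists B : set 'rV[R]_d,
    measurable B /\ (lebesgue_rV d).-negligible ((E `\` B) `|` (B `\` E)).

(* Elements of L^2(R^d) are represented by Borel measurable functions
   'rV[R]_d -> R[i]; every Lebesgue class has such a representative. *)
Section L2.
Context {R : realType} {d : nat}.
Implicit Types (f g h : 'rV[R]_d -> R[i]).

Local Notation mu := (lebesgue_rV d : {measure set 'rV[R]_d -> \bar R}).

Definition cmeasurable f :=
  measurable_fun [set: 'rV[R]_d] (fun x => complex.Re (f x)) /\
  measurable_fun [set: 'rV[R]_d] (fun x => complex.Im (f x)).

Definition cintegral f : R[i] :=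
  (\int[mu]_x complex.Re (f x)) +i* (\int[mu]_x complex.Im (f x)).

Definition L1 f :=
  cmeasurable f /\ (\int[mu]_x (Normc.normc (f x))%:E < +oo)%E.

Definition sqnormL2 f : \bar R := (\int[mu]_x (Normc.normc (f x) ^+ 2)%:E)%E.

Definition L2 f := cmeasurable f /\ (sqnormL2 f < +oo)%E.

Definition innerL2 f g : R[i] := cintegral (fun x => f x * conjc (g x)).

Definition cvgL2 (u : nat -> 'rV[R]_d -> R[i]) f :=
  (fun n => sqnormL2 (fun x => u n x - f x)) @ \oo --> 0%E.

Definition dotp (x y : 'rV[R]_d) : R := \sum_(i < d) x ord0 i * y ord0 i.

Definition expi (t : R) : R[i] := cos t +i* sin t.

Definition fourierL1 f (w : 'rV[R]_d) : R[i] :=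
  cintegral (fun x => f x * expi (- (2 * pi * dotp w x))).

(* g is a representative of the Fourier transform of f, the latter being
   extended from L^1 `&` L^2 to L^2 by density and continuity. *)
Definition is_fourierL2 f g :=
  [/\ L2 f, L2 g &
    exists u : nat -> 'rV[R]_d -> R[i],
      [/\ forall n, L1 (u n) /\ L2 (u n),
          cvgL2 u f &
          cvgL2 (fun n => fourierL1 (u n)) g]].

(* P_E *)
Definition paley_wiener (E : set 'rV[R]_d) : set ('rV[R]_d -> R[i]) :=
  [set f | exists g, is_fourierL2 f g /\
                     {ae mu, forall w, ~ E w -> g w = 0}].

Definition translate (a : 'rV[R]_d) f : 'rV[R]_d -> R[i] := fun x => f (x - a).

Definition is_frame (H : set ('rV[R]_d -> R[i])) (K : countType)
    (psi : K -> 'rV[R]_d -> R[i]) :=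
  (forall k, H (psi k)) /\
  exists A B : R, [/\ 0 < A, 0 < B & forall f, H f ->
    (A%:E * sqnormL2 f
      <= \esum_(k in [set: K]) (Normc.normc (innerL2 f (psi k)) ^+ 2)%:E
      <= B%:E * sqnormL2 f)%E].

End L2.

(* Main.v *)
(** Let phi be the continuous representative of the Fourier transform of h.
    On the Fourier side the frame inequalities read
      A |g|^2 <= sum_k |<g e_k, phi>|^2 <= B |g|^2,   e_k w = e^(2 i pi w.lambda_k),
    for g in L^1 and L^oo vanishing outside E. If phi vanished identically, the
    lower bound would fail for g = 1_E gam, where gam is positive and integrable.
    Otherwise |phi| takes every small value, since phi vanishes a.e. off the
    bounded set E. Pick a cube Q on which |phi| > del and a translate Q + v on
    which 0 < |phi| < del s. Translating by v only multiplies each pairing by a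
    phase, so g = 1_(Q + v) and F = 1_Q conj(phi(. + v)) / conj(phi) yield the
    same sum, whence A |Q| <= B s^2 |Q|: a contradiction for small s.
    The passage to the Fourier side rests on Plancherel's theorem for g in L^1 and
    L^oo: the inverse transform of g, multiplied by gam(./n), has as transform
    the convolution of g with the Poisson kernel of width 1/n, which tends to g
    in L^1, hence in L^2 as both are bounded. *)

Require Import Defs.
From HB Require Import structures.
From mathcomp Require Import all_boot all_order all_algebra.
From mathcomp Require Import all_classical all_reals all_analysis.
From mathcomp Require Import measurable_realfun complex ring lra.

Set Implicit Arguments.
Unset Strict Implicit.
Unset Printing Implicit Defensive.

Import Order.TTheory GRing.Theory Num.Theory.
Import numFieldNormedType.Exports.

Local Open Scope classical_set_scope.
Local Open Scope ring_scope.
Local Open Scope complex_scope.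

(** * Changes of variables for Lebesgue measure *)

Section lebesgue1.
Context {R : realType}.
Local Notation leb := (@lebesgue_measure R).
Local Open Scope ereal_scope.

(** Testing the frame only on inverse transforms of bounded integrable [g] keeps the L^2 theory
    small: the coefficients involve just the pairing of [ifourierL1 g] with [h], which the
    approximating sequence inside [is_fourierL2] delivers by Fubini and a limit. An exponential of
    -|x| is preferred to a Gaussian because its product with a cosine has an elementary primitive;
    tensor products then carry the computation to dimension d. In the final comparison the phase
    caused by the translation depends on k but not on w, so it disappears from each modulus
    separately, whatever the points lambda_k are. That [phi] is nonzero on both cubes has a second
    use: since [phi] vanishes a.e. off [E], both cubes lie in [E] up to null sets, which makes the
    two test functions admissible even if [E] has empty interior. Finally F conj(phi) = conj(phi(. +
    v)) holds exactly on Q, and |F| <= s there, because |phi(. + v)| < del s while |phi| > del. *)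

Lemma ge0_integral_shift (a : R) (f : R -> \bar R) :
  measurable_fun [set: _] f -> (forall x, 0 <= f x) ->
  \int[leb]_x f (x + a)%R = \int[leb]_x f x.
Proof.
move=> mf f0.
have ms : measurable_fun [set: measurableTypeR R]
    ((fun x => x + a)%R : measurableTypeR R -> measurableTypeR R).
  exact: measurable_funD.
have -> : \int[leb]_x f x =
    \int[pushforward leb ((fun x => x + a)%R : measurableTypeR R -> measurableTypeR
        R)]_x f x.
  (* Lebesgue measure is determined by its values on half-open intervals, so agreement of the
     shifted measure on these is enough. *)
  apply: eq_measure_integral => /= A mA _.
  apply: (@lebesgue_measure_unique R (pushforward leb ((fun x => x + a)%R :
      measurableTypeR R -> measurableTypeR R))) => //= _ [[b c]] _ <-.
  rewrite /pushforward [X in _ = _ X](_ : _ = `](b - a)%R, (c - a)%R]%classic).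
    rewrite !lebesgue_measure_itv/= !lte_fin ltrD2r.
    by case: ifP => // _; rewrite -!EFinD; congr EFin; ring.
  by apply/seteqP; split => x /=; rewrite !in_itv/= lerBrDr ltrBlDr.
by rewrite ge0_integral_pushforward.
Qed.

(** The uniqueness argument for shifts again, applied to [c] times the pushforward: the factor makes
    up for the division of lengths by [c] in preimages. *)
Lemma ge0_integral_scale (c : R) (f : R -> \bar R) : (0 < c)%R ->
  measurable_fun [set: _] f -> (forall x, 0 <= f x) ->
  c%:E * \int[leb]_x f (c * x)%R = \int[leb]_x f x.
Proof.
move=> c0 mf f0.
pose s := (fun x => c * x)%R : measurableTypeR R -> measurableTypeR R.
have ms : measurable_fun [set: measurableTypeR R] s.
  exact: measurable_funM.
have c0' : (0 <= c)%R by exact: ltW.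
pose m : {measure set (measurableTypeR R) -> \bar R} :=
  measure_function_pushforward__canonical__measure_function_Measure leb ms.
have -> : \int[leb]_x f x =
    \int[mscale (NngNum c0') m]_x f x.
  apply: eq_measure_integral => /= A mA _.
  apply: (@lebesgue_measure_unique R (mscale (NngNum c0') m)) => //= _ [[b d]] _ <-.
  rewrite /mscale/= /pushforward [X in _ = _ * _ X](_ : _ = `](b / c)%R, (d /
      c)%R]%classic).
    rewrite !lebesgue_measure_itv/= !lte_fin ltr_pM2r ?invr_gt0//.
    case: ifP => // _; last by rewrite mule0.
    rewrite -!EFinD -EFinM; congr EFin; field; exact: lt0r_neq0.
  apply/seteqP; split => x /=;
  by rewrite !in_itv/= /s ler_pdivlMr// ltr_pdivrMr// [(_ * c)%R]mulrC.
by rewrite ge0_integral_mscale//= ge0_integral_pushforward.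
Qed.

End lebesgue1.

Section lebesgue_rV.
Context {R : realType}.
Local Notation leb := (@lebesgue_measure R).
Local Notation mu d := (@lebesgue_rV R d).
Local Open Scope ereal_scope.

(** [lebesgue_rV n.+1] is by construction the pushforward of a product measure, so Tonelli peels off
    one coordinate. The changes of variables below are inductions on the dimension through this
    identity. *)
Lemma ge0_integral_rV_cons n (f : 'rV[R]_n.+1 -> \bar R) :
  measurable_fun [set: _] f -> (forall x, 0 <= f x) ->
  \int[mu n.+1]_x f x = \int[leb]_a \int[mu n]_x f (rV_cons (a, x)).
Proof.
move=> mf f0.
rewrite (_ : \int[mu n.+1]_x f x = \int[pushforward (leb \x mu n) (@rV_cons R n)]_x f
    x)//.
rewrite ge0_integral_pushforward//; last exact: measurable_rV_cons.
rewrite preimage_setT (fubini_tonelli1 (f \o @rV_cons R n))//.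
  by apply: measurableT_comp => //; exact: measurable_rV_cons.
by move=> x; exact: f0.
Qed.

Lemma measurable_rV_shift n (v : 'rV[R]_n) :
  measurable_fun [set: 'rV[R]_n] (fun x => x + v)%R.
Proof.
apply: measurable_fun_rV => i.
apply: (eq_measurable_fun (fun x : 'rV[R]_n => x ord0 i + v ord0 i)%R).
  by move=> x _; rewrite mxE.
apply: measurable_funD => //; exact: (@measurable_rV_coord _ R).
Qed.

Lemma measurable_rV_scale n (c : R) :
  measurable_fun [set: _] (fun x : 'rV[R]_n => c *: x)%R.
Proof.
apply: measurable_fun_rV => i.
apply: (eq_measurable_fun (fun x : 'rV[R]_n => c * x ord0 i)%R).
  by move=> x _; rewrite mxE.
apply: measurable_funM => //; exact: (@measurable_rV_coord _ R).
Qed.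

Lemma rV_consD n a b (x y : 'rV[R]_n) :
  (rV_cons (a, x) + rV_cons (b, y))%R = rV_cons ((a + b)%R, (x + y)%R).
Proof. by apply/rowP => i; rewrite !mxE; case: unliftP => [j|] _//=; rewrite mxE. Qed.

Lemma rV_consZ n c a (x : 'rV[R]_n) :
  (c *: rV_cons (a, x))%R = rV_cons ((c * a)%R, (c *: x)%R).
Proof. by apply/rowP => i; rewrite !mxE; case: unliftP => [j|] _//=; rewrite mxE. Qed.

Lemma measurable_rV_consr n (a : R) : measurable_fun [set: _] (fun x : 'rV[R]_n =>
    rV_cons (a, x)).
Proof.
apply: (measurableT_comp (@measurable_rV_cons R n)).
exact: measurable_pair1.
Qed.

Lemma ge0_integral_rV_shift n (v : 'rV[R]_n) (f : 'rV[R]_n -> \bar R) :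
  measurable_fun [set: _] f -> (forall x, 0 <= f x) ->
  \int[mu n]_x f (x + v)%R = \int[mu n]_x f x.
Proof.
elim: n v f => [|n ih] v f mf f0.
  by apply: eq_integral => x _; rewrite [v]thinmx0 addr0.
rewrite !ge0_integral_rV_cons//; last first.
  by apply: measurableT_comp => //; exact: measurable_rV_shift.
rewrite -(@rV_unconsK _ _ v); case: (rV_uncons v) => b y.
under eq_integral => a _.
  under eq_integral do rewrite rV_consD.
  rewrite (ih _ (fun x => f (rV_cons ((a + b)%R, x)))) => [|//|//]; last first.
    exact: (measurableT_comp mf (measurable_rV_consr _)).
  over.
rewrite /= (ge0_integral_shift _ (f := fun a => \int[mu n]_x f (rV_cons (a, x))))//.
  apply: (measurable_fun_fubini_tonelli_F (f \o @rV_cons R n)) => //=.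
  by apply: measurableT_comp => //; exact: measurable_rV_cons.
by move=> x; apply: integral_ge0.
Qed.

Lemma ge0_integral_rV_scale n (c : R) (f : 'rV[R]_n -> \bar R) : (0 < c)%R ->
  measurable_fun [set: _] f -> (forall x, 0 <= f x) ->
  (c ^+ n)%:E * \int[mu n]_x f (c *: x)%R = \int[mu n]_x f x.
Proof.
move=> c0; elim: n f => [|n ih] f mf f0.
  by rewrite expr0 mul1e; apply: eq_integral => x _; rewrite [x]thinmx0 scaler0.
rewrite !ge0_integral_rV_cons//; last first.
  by apply: measurableT_comp => //; exact: measurable_rV_scale.
have mF : measurable_fun [set: _] (fun a : measurableTypeR R => \int[mu n]_x f (rV_cons
    (a, x))).
  apply: (measurable_fun_fubini_tonelli_F (f \o @rV_cons R n)) => //=.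
  by apply: measurableT_comp => //; exact: measurable_rV_cons.
rewrite -[RHS](@ge0_integral_scale _ c)//; last by move=> x; apply: integral_ge0.
rewrite exprS EFinM -muleA; congr (_ * _).
rewrite -ge0_integralZl//; last 3 first.
- apply: (measurable_fun_fubini_tonelli_F (fun p : measurableTypeR R * 'rV[R]_n => f (c
    *: rV_cons p)%R)) => //=.
  apply: (measurableT_comp mf).
  apply: measurableT_comp; [exact: measurable_rV_scale|exact: measurable_rV_cons].
- by move=> x _; apply: integral_ge0.
- by rewrite lee_fin exprn_ge0// ltW.
apply: eq_integral => a _.
rewrite -[RHS](ih (fun x => f (rV_cons ((c * a)%R, x))))//; last first.
  exact: (measurableT_comp mf (measurable_rV_consr _)).
by under eq_integral do rewrite rV_consZ.
Qed.

(** Meant for integrands carrying sines and cosines, where Tonelli does not apply. Integrability is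
    proved along with the factorisation because the inductions on the dimension consume both. *)
Lemma integral_rV_tensor n (f : R -> R) (g : 'rV[R]_n -> R) :
  leb.-integrable setT (EFin \o f) -> (mu n).-integrable setT (EFin \o g) ->
  (mu n.+1).-integrable setT
    (fun x => (f (rV_uncons x).1 * g (rV_uncons x).2)%:E) /\
  (\int[mu n.+1]_x (f (rV_uncons x).1 * g (rV_uncons x).2) =
   \int[leb]_x f x * \int[mu n]_x g x)%R.
Proof.
move=> fi gi.
have mf : measurable_fun [set: _] f by apply/measurable_EFinP; exact: measurable_int fi.
have mg : measurable_fun [set: _] g by apply/measurable_EFinP; exact: measurable_int gi.
pose F := fun p : measurableTypeR R * 'rV[R]_n => (f p.1 * g p.2)%:E.
have mF : measurable_fun [set: _] F.
  apply/measurable_EFinP/measurable_funM.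
    exact: (measurableT_comp mf (@measurable_fst _ _ _ _)).
  exact: (measurableT_comp mg (@measurable_snd _ _ _ _)).
have iF : (leb \x mu n).-integrable setT F.
  apply/integrable12ltyP => //=.
  under eq_integral => x _.
    under eq_integral do rewrite /F/= normrM EFinM.
    rewrite ge0_integralZl//; last by apply/measurable_EFinP; exact: measurableT_comp.
    over.
  rewrite /=; have /integrableP[_ gy] := gi; have /integrableP[_ fy] := fi.
  rewrite ge0_integralZr//; first by apply: lte_mul_pinfty => //; rewrite
      ?ge0_fin_numE//; apply: integral_ge0.
    by apply/measurable_EFinP; exact: measurableT_comp.
  exact: integral_ge0.
have FE : (fun x => (f (rV_uncons x).1 * g (rV_uncons x).2)%:E) \o @rV_cons R n = F.
  by apply/funext => p; rewrite /comp rV_consK.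
have mG : measurable_fun [set: _] (fun x => (f (rV_uncons x).1 * g (rV_uncons x).2)%:E).
  by apply: (measurableT_comp mF); exact: measurable_rV_uncons.
split.
  apply: (@integrable_pushforward _ _ _ _ _ (@rV_cons R n) _ (leb \x mu n)) => //.
    exact: measurable_rV_cons.
  by rewrite preimage_setT FE.
rewrite /Rintegral -fineM; last 2 first.
- exact: integrable_fin_num.
- exact: integrable_fin_num.
congr fine.
transitivity (\int[leb \x mu n]_z F z).
  rewrite -FE -[in RHS](preimage_setT (@rV_cons R n)).
  rewrite -(@integral_pushforward _ _ _ _ _ (@rV_cons R n)) => [//| | |//|//].
  - exact: measurable_rV_cons.
  - exact: mG.
  - by rewrite preimage_setT FE.
rewrite -integral12_prod_meas1// /fubini_F /=.
under eq_integral => x _.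
  rewrite /F/=; under eq_integral do rewrite EFinM.
  rewrite integralZl//.
  over.
rewrite /= -[X in _ = _ * X]fineK ?integrable_fin_num//.
rewrite -[in RHS]integralZr//; apply: eq_integral => x _.
by rewrite fineK ?integrable_fin_num.
Qed.

End lebesgue_rV.

(** * The Poisson kernel *)

Section kernel1.
Context {R : realType}.
Local Notation leb := (@lebesgue_measure R).

(** The damping factor in one variable; the constant [2 * pi] matches the normalisation of the
    transform, so that its transform is the Poisson kernel of width 1. *)
Definition gam1 (x : R) : R := expR (- (2 * pi * `|x|)).

(* The Fourier transform of [gam1]. *)
Definition pk1 (v : R) : R := (pi * (1 + v ^+ 2))^-1.

Lemma gam1_ge0 x : 0 <= gam1 x. Proof. exact: expR_ge0. Qed.

Lemma pk1_ge0 v : 0 <= pk1 v.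
Proof. by rewrite invr_ge0 mulr_ge0 ?pi_ge0// addr_ge0// sqr_ge0. Qed.

Lemma continuous_gam1 : continuous gam1.
Proof.
move=> x; apply: (@continuous_comp _ _ _ (fun x : R => - (2 * pi * `|x|)) expR).
  apply: continuousN; apply: continuousM; first exact: cst_continuous.
  exact: norm_continuous.
exact: continuous_expR.
Qed.

Lemma continuous_pk1 : continuous pk1.
Proof.
move=> x; apply: (@cvgV _ _ _ _ (fun v : R => pi * (1 + v ^+ 2))).
  by rewrite mulf_neq0 ?gt_eqF ?pi_gt0// ltr_pwDl// sqr_ge0.
apply: cvgM; first exact: cvg_cst.
exact: continuous_oneDsqr.
Qed.

Lemma measurable_gam1 : measurable_fun [set: R] gam1.
Proof. exact: continuous_measurable_fun continuous_gam1. Qed.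

Lemma measurable_pk1 : measurable_fun [set: R] pk1.
Proof. exact: continuous_measurable_fun continuous_pk1. Qed.

(** By evenness it is twice the arctangent integral over the half-line. This normalisation is what
    makes the rescaled kernels an approximate identity. *)
Lemma ge0_integral_pk1 : (\int[leb]_x (pk1 x)%:E = 1)%E.
Proof.
rewrite ge0_symfun_integralT//=; last 3 first.
- exact: pk1_ge0.
- exact: continuous_pk1.
- by move=> x /=; rewrite /pk1 sqrrN.
rewrite -set_itvcy.
under eq_integral => x _ do rewrite /pk1 invfM EFinM.
rewrite ge0_integralZl//=; last 3 first.
- by apply/measurable_EFinP; apply: measurable_funTS;
    apply: continuous_measurable_fun; exact: continuous_oneDsqrV.
- by move=> x _; rewrite lee_fin invr_ge0 addr_ge0// sqr_ge0.
- by rewrite lee_fin invr_ge0 pi_ge0.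
rewrite [X in (_ * (_ * X))%E](_ : _ = (pi / 2)%:E); last exact: integral0y_oneDsqr.
rewrite -!EFinM; congr EFin.
move: (pi : R) (pi_gt0 R) => p p0; field.
by rewrite gt_eqF.
Qed.

(** The first summand is a primitive for the constant 1; the second is the real part of e^((-b +
    ic)x) / (-b + ic). *)
Let F (b c x : R) : R :=
  - (expR (- (b * x)) / b) +
  expR (- (b * x)) * ((c * sin (c * x) - b * cos (c * x)) / (b ^+ 2 + c ^+ 2)).

Let is_derive_F (b c x : R) : 0 < b ->
  is_derive (x : R^o) 1 (F b c : R^o -> R^o) (expR (- (b * x)) * (1 + cos (c * x))).
Proof.
move=> b0.
have dl a : is_derive x 1 (fun x : R => a * x) a.
  have := @is_deriveZ _ _ _ (id : R -> R) a x 1 1 _.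
  by move=> /(_ (is_derive_id _ _)); rewrite [a *: 1]mulr1.
have de : is_derive x 1 (fun x : R => expR (- (b * x))) (- b * expR (- (b * x))).
  rewrite mulrC.
  apply: (@is_derive1_comp _ expR (fun x : R => - (b * x))).
have ds : is_derive x 1 (fun x : R => sin (c * x)) (c * cos (c * x)).
  rewrite mulrC; exact: (@is_derive1_comp _ sin (fun x : R => c * x)).
have dc : is_derive x 1 (fun x : R => cos (c * x)) (- c * sin (c * x)).
  rewrite mulrC mulrN -mulNr; exact: (@is_derive1_comp _ cos (fun x : R => c * x)).
have b20 : b ^+ 2 + c ^+ 2 != 0.
  by rewrite gt_eqF// ltr_pwDl ?sqr_ge0// exprn_gt0.
pose n2 := b ^+ 2 + c ^+ 2.
have dZ (k : R) (f : R -> R) (df : R) :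
    is_derive (x : R^o) 1 (f : R^o -> R^o) df ->
    is_derive (x : R^o) 1 ((fun x => k * f x) : R^o -> R^o) (k * df).
  move=> fd; exact: (@is_deriveZ _ _ _ (f : R^o -> R^o) k x 1 df fd).
have {}ds := dZ (c / n2) _ _ ds; have {}dc := dZ (- (b / n2)) _ _ dc.
have dE := dZ (- b^-1) _ _ de.
rewrite (_ : F b c = (fun x => (- b^-1) * expR (- (b * x))) +
  (fun x => expR (- (b * x))) * ((fun x => c / n2 * sin (c * x))
   + (fun x => - (b / n2) * cos (c * x)))); last first.
  apply/funext => y; rewrite /F !fctE /n2; field.
  by rewrite b20 gt_eqF.
apply: (@is_derive_eq _ _ _ _ _ _ _ _ (is_deriveD dE (is_deriveM de (is_deriveD ds dc)))).
rewrite !fctE /GRing.scale/= /n2; field.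
by rewrite b20 gt_eqF.
Qed.

(* Adding 1 to the cosine makes the integrand nonnegative, as the improper form
   of the fundamental theorem of calculus requires. *)
Lemma integral_expR_cos (b c : R) : 0 < b ->
  (\int[leb]_x (expR (- (b * `|x|)) * (1 + cos (c * x)))%:E =
   (2 / b + 2 * b / (b ^+ 2 + c ^+ 2))%:E)%E.
Proof.
move=> b0.
have cf : continuous (fun x : R => expR (- (b * `|x|)) * (1 + cos (c * x))).
  move=> x; apply: cvgM.
    apply: (@continuous_comp _ _ _ (fun x : R => - (b * `|x|)) expR).
      apply: continuousN; apply: continuousM; first exact: cst_continuous.
      exact: norm_continuous.
    exact: continuous_expR.
  apply: cvgD; first exact: cvg_cst.
  apply: (@continuous_comp _ _ _ (fun x : R => c * x) cos).
    exact: mulrl_continuous.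
  exact: continuous_cos.
have f0 x : 0 <= expR (- (b * `|x|)) * (1 + cos (c * x)).
  by rewrite mulr_ge0 ?expR_ge0// -lerBlDl sub0r cos_geN1.
rewrite ge0_symfun_integralT//=; last first.
  by move=> x /=; rewrite normrN mulrN cosN.
rewrite -set_itvcy.
rewrite (@ge0_continuous_FTC2y _ _ (F b c) 0 0)//.
- rewrite /F !mulr0 sin0 cos0 oppr0 expR0 -EFinB -EFinM; congr EFin.
  field.
  by rewrite !gt_eqF// ltr_pwDl ?sqr_ge0// exprn_gt0.
- exact: continuous_subspaceT.
- have ex : expR (- (b * x)) @[x --> +oo] --> (0 : R).
    apply: (@cvg_comp _ _ _ (fun x : R => b * x) (fun x : R => expR (- x)) _ +oo).
      by apply: gt0_cvgMry => //; exact: cvg_id.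
    exact: cvgr_expR.
  rewrite /F -[X in _ --> X]addr0; apply: cvgD.
    rewrite -oppr0 -(mul0r b^-1); apply: cvgN; apply: cvgM => //; exact: cvg_cst.
  apply/cvgr0Pnorm_lt => /= e e0.
  (* This quotient bounds the trigonometric factor of the primitive, so the decay of the exponential
     alone gives the limit 0. *)
  have M0 : 0 < (`|c| + b) / (b ^+ 2 + c ^+ 2).
    rewrite divr_gt0//; first by have := normr_ge0 c; lra.
    by rewrite ltr_pwDl ?sqr_ge0// exprn_gt0.
  move/cvgr0Pnorm_lt : ex => /(_ (e / ((`|c| + b) / (b ^+ 2 + c ^+ 2)))).
  rewrite divr_gt0// => /(_ isT); apply: filterS => x.
  rewrite ltr_pdivlMr// => /(le_lt_trans _); apply.
  rewrite normrM ler_wpM2l// normrM [X in _ * X]gtr0_norm ?invr_gt0; last first.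
    by rewrite ltr_pwDl ?sqr_ge0// exprn_gt0.
  rewrite ler_wpM2r ?invr_ge0 ?addr_ge0 ?sqr_ge0//.
  rewrite (le_trans (ler_normB _ _))// !normrM lerD//.
    by rewrite ler_piMr// ler_norml sin_geN1 sin_le1.
  rewrite (gtr0_norm b0) ler_piMr//; first exact: ltW.
  by rewrite ler_norml cos_geN1 cos_le1.
- apply: cvg_at_right_filter.
  apply/differentiable_continuous/derivable1_diffP.
  by have [] := @is_derive_F b c 0 b0.
- move=> x; rewrite in_itv/= andbT => x0.
  rewrite derive1E; have [_ ->] := @is_derive_F b c x b0.
  by rewrite gtr0_norm.
Qed.

(** Dominated by the integrand of [integral_expR_cos] at frequency 0, which is twice [gam1]. *)
Lemma integrable_gam1 : leb.-integrable setT (EFin \o gam1).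
Proof.
apply/integrableP; split; first by apply/measurable_EFinP; exact: measurable_gam1.
have b0 : 0 < 2 * pi :> R by rewrite mulr_gt0 ?pi_gt0.
have h := @integral_expR_cos _ 0 b0.
apply: (@le_lt_trans _ _ (\int[leb]_x (expR (- (2 * pi * `|x|)) * (1 + cos (0 *
    x)))%:E)%E); last first.
  by rewrite h ltry.
apply: ge0_le_integral => //.
- apply/measurable_EFinP; apply: measurableT_comp => //.
  exact: measurable_gam1.
- apply/measurable_EFinP; apply: measurable_funM.
    exact: measurable_gam1.
  by under eq_fun do rewrite mul0r cos0; exact: measurable_cst.
- move=> x _; rewrite lee_fin mul0r cos0 ger0_norm ?gam1_ge0// /gam1.
  rewrite ler_peMr ?expR_ge0//; lra.
Qed.

Lemma integrable_gam1M (h : R -> R) : measurable_fun [set: R] h ->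
  (forall x, `|h x| <= 1) -> leb.-integrable setT (EFin \o (fun x => gam1 x * h x)).
Proof.
move=> mh h1.
apply: (le_integrable _ _ _ integrable_gam1) => //.
- apply/measurable_EFinP; apply: measurable_funM => //; exact: measurable_gam1.
- by move=> x _; rewrite /= lee_fin normrM ler_piMr.
Qed.

(** Half the value of [integral_expR_cos] at frequency 0 is the integral of [gam1]; subtracting it
    from the value at frequency [2 * pi * v] removes the 1 that was added to the cosine. *)
Lemma integral_gam1_cos (v : R) :
  (\int[leb]_x (gam1 x * cos (2 * pi * (v * x))) = pk1 v)%R.
Proof.
have b0 : 0 < 2 * pi :> R by rewrite mulr_gt0 ?pi_gt0.
have mc : measurable_fun [set: R] (fun x => cos (2 * pi * (v * x))).
  apply: (measurableT_comp (continuous_measurable_fun (@continuous_cos R))).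
  by apply: measurable_funM => //; exact: measurable_funM.
have E (c : R) : (\int[leb]_x (gam1 x * (1 + cos (c * x))) =
   (2 / (2 * pi) + 2 * (2 * pi) / ((2 * pi) ^+ 2 + c ^+ 2)))%R.
  by rewrite /Rintegral integral_expR_cos.
have := E 0; rewrite /=.
under eq_Rintegral do rewrite mul0r cos0.
rewrite RintegralZr//; last exact: integrable_gam1.
move=> E0.
have := E (2 * pi * v).
under eq_Rintegral do rewrite mulrDr mulr1 -[2 * pi * v * _]mulrA.
rewrite RintegralD//; last 2 first.
- exact: integrable_gam1.
- apply: integrable_gam1M => // x.
  by rewrite ler_norml cos_geN1 cos_le1.
move=> Ev; apply: (addrI (\int[leb]_x (gam1 x))).
rewrite Ev; apply: (mulIf (x := 1 + 1)); first by rewrite gt_eqF.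
rewrite [RHS]mulrDl E0 /pk1.
move: (pi : R) (pi_gt0 R) => p p0; field.
rewrite !gt_eqF//.
  by rewrite ltr_pwDl ?sqr_ge0// exprn_gt0// mulr_gt0.
by rewrite ltr_pwDl ?sqr_ge0.
Qed.

(** The integrand is odd, so reflection invariance of Lebesgue measure makes the integral its own
    opposite. *)
Lemma integral_gam1_sin (v : R) :
  (\int[leb]_x (gam1 x * sin (2 * pi * (v * x))) = 0)%R.
Proof.
pose f x := gam1 x * sin (2 * pi * (v * x)).
have mc : measurable_fun [set: R] (fun x => sin (2 * pi * (v * x))).
  apply: (measurableT_comp (continuous_measurable_fun (@continuous_sin R))).
  by apply: measurable_funM => //; exact: measurable_funM.
have fi : leb.-integrable setT (EFin \o f).
  apply: integrable_gam1M => // x.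
  by rewrite ler_norml sin_geN1 sin_le1.
have fN x : f (- x) = - f x.
  by rewrite /f /gam1 normrN !mulrN sinN mulrN.
suff : (\int[leb]_x (f x) = - \int[leb]_x (f x))%R.
  by move/eqP; rewrite -subr_eq0 opprK -mulr2n mulrn_eq0/= => /eqP.
rewrite -[X in - X]mul1r -mulNr -RintegralZl//.
rewrite [LHS]/Rintegral [RHS]/Rintegral; congr fine.
transitivity (\int[pushforward leb (-%R : measurableTypeR R -> measurableTypeR R)]_x (f
    x)%:E)%E.
  by apply: eq_measure_integral => //= A mA _; exact/esym/lebesgue_measureN.
rewrite (@integral_pushforward _ _ _ _ _ (-%R : measurableTypeR R -> measurableTypeR
    R))//=.
- by apply: eq_integral => x _; rewrite fN mulN1r.
- exact: measurable_int fi.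
- rewrite (_ : _ \o _ = (fun x => (-1)%:E * (f x)%:E)%E); last first.
    by apply/funext => x /=; rewrite fN -EFinM mulN1r.
  exact: (integrableZl _ _ fi).
Qed.

End kernel1.

(** * Integration of complex functions *)

Section complex_norm.
Context {R : rcfType}.
Implicit Types z w : R[i].
Local Notation N := (@Normc.normc R).

Lemma normc_ge0 z : 0 <= N z.
Proof. by case: z => a b; exact: sqrtr_ge0. Qed.

Lemma normc_sqr z : N z ^+ 2 = complex.Re z ^+ 2 + complex.Im z ^+ 2.
Proof. by case: z => a b /=; rewrite sqr_sqrtr// addr_ge0 ?sqr_ge0. Qed.

Lemma Re_le_normc z : `|complex.Re z| <= N z.
Proof.
case: z => a b /=; rewrite -[leLHS]sqrtr_sqr.
by rewrite ler_wsqrtr// lerDl sqr_ge0.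
Qed.

Lemma Im_le_normc z : `|complex.Im z| <= N z.
Proof.
case: z => a b /=; rewrite -[leLHS]sqrtr_sqr.
by rewrite ler_wsqrtr// lerDr sqr_ge0.
Qed.

Lemma normcJ z : N (conjc z) = N z.
Proof. by case: z => a b /=; rewrite sqrrN. Qed.

Lemma normcR (a : R) : N a%:C = `|a|.
Proof. by rewrite /= expr0n addr0 sqrtr_sqr. Qed.

Lemma normc_le z : N z <= `|complex.Re z| + `|complex.Im z|.
Proof.
case: z => a b.
rewrite -ler_sqr ?nnegrE ?normc_ge0 ?addr_ge0// normc_sqr/= sqrrD !real_normK ?num_real//.
by rewrite addrAC lerDl mulrn_wge0// mulr_ge0.
Qed.

Lemma normcB z w : N (z - w) = N (w - z).
Proof. by rewrite -normcN opprB. Qed.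

Lemma mulcJ z : z * conjc z = (N z ^+ 2)%:C.
Proof. by rewrite normc_sqr; case: z => a b; rewrite /=; simpc; congr Complex; ring. Qed.

End complex_norm.

Section complex_integral.
Context d (T : measurableType d) {R : realType} (mu : {measure set T -> \bar R}).
Implicit Types f g : T -> R[i].
Local Notation N := (@Normc.normc R).

(** Stated over an arbitrary measure space because Fubini involves two of them. On row vectors
    [cmfun], [cL1] and [cint] are convertible to [cmeasurable], [L1] and [cintegral], and later
    proofs pass silently from one to the other. *)
Definition cmfun f := measurable_fun [set: T] (fun x => complex.Re (f x)) /\
  measurable_fun [set: T] (fun x => complex.Im (f x)).

Definition cL1 f := cmfun f /\ (\int[mu]_x (N (f x))%:E < +oo)%E.

Definition cint f : R[i] :=
  (\int[mu]_x complex.Re (f x)) +i* (\int[mu]_x complex.Im (f x)).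

Lemma cmfun_cst (c : R[i]) : cmfun (fun=> c).
Proof. by split; exact: measurable_cst. Qed.

Lemma cmfun_real (h : T -> R) : measurable_fun [set: T] h -> cmfun (fun x => (h x)%:C).
Proof. by move=> mh; split => //=; exact: measurable_cst. Qed.

Lemma cmfunD f g : cmfun f -> cmfun g -> cmfun (fun x => f x + g x).
Proof.
move=> [fr fi] [gr gi]; split.
- rewrite (_ : (fun _ => _) = fun x => complex.Re (f x) + complex.Re (g x)).
    exact: measurable_funD.
  by apply/funext => x; case: (f x) (g x) => a b [].
- rewrite (_ : (fun _ => _) = fun x => complex.Im (f x) + complex.Im (g x)).
    exact: measurable_funD.
  by apply/funext => x; case: (f x) (g x) => a b [].
Qed.

Lemma cmfunM f g : cmfun f -> cmfun g -> cmfun (fun x => f x * g x).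
Proof.
move=> [fr fi] [gr gi]; split.
- rewrite (_ : (fun _ => _) = fun x => complex.Re (f x) * complex.Re (g x) -
      complex.Im (f x) * complex.Im (g x)).
    by apply: measurable_funB; exact: measurable_funM.
  by apply/funext => x; case: (f x) (g x) => a b [].
- rewrite (_ : (fun _ => _) = fun x => complex.Re (f x) * complex.Im (g x) +
      complex.Im (f x) * complex.Re (g x)).
    by apply: measurable_funD; exact: measurable_funM.
  by apply/funext => x; case: (f x) (g x) => a b [].
Qed.

Lemma cmfunJ f : cmfun f -> cmfun (fun x => conjc (f x)).
Proof.
move=> [fr fi]; split.
- rewrite (_ : (fun _ => _) = fun x => complex.Re (f x))//.
  by apply/funext => x; case: (f x).
- rewrite (_ : (fun _ => _) = fun x => - complex.Im (f x)).
    exact: measurable_funN.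
  by apply/funext => x; case: (f x).
Qed.

Lemma cmfunN f : cmfun f -> cmfun (fun x => - f x).
Proof.
move=> mf; rewrite (_ : (fun _ => _) = fun x => (-1) * f x).
  by apply: cmfunM => //; exact: cmfun_cst.
by apply/funext => x; rewrite mulN1r.
Qed.

Lemma cmfunB f g : cmfun f -> cmfun g -> cmfun (fun x => f x - g x).
Proof. by move=> mf mg; apply: cmfunD => //; exact: cmfunN. Qed.

Lemma measurable_normc f : cmfun f -> measurable_fun [set: T] (fun x => N (f x)).
Proof.
move=> [fr fi]; rewrite (_ : (fun _ => _) =
  fun x => Num.sqrt (complex.Re (f x) ^+ 2 + complex.Im (f x) ^+ 2)).
  apply: (measurableT_comp (continuous_measurable_fun (@sqrt_continuous R))).
  by apply: measurable_funD; exact: measurable_funX.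
by apply/funext => x; case: (f x).
Qed.

Lemma measurable_normc_sqr f : cmfun f ->
  measurable_fun [set: T] (fun x => N (f x) ^+ 2).
Proof. by move=> mf; apply: measurable_funX; exact: measurable_normc. Qed.

Lemma cL1_normc f : cL1 f -> mu.-integrable [set: T] (fun x => (N (f x))%:E).
Proof.
move=> [mf fy]; apply/integrableP; split.
  by apply/measurable_EFinP; exact: measurable_normc.
by under eq_integral do rewrite /= ger0_norm ?normc_ge0//.
Qed.

Lemma cL1_Re f : cL1 f -> mu.-integrable [set: T] (EFin \o (fun x => complex.Re (f x))).
Proof.
move=> f1; apply: (le_integrable _ _ _ (cL1_normc f1)) => //.
  by apply/measurable_EFinP; have [[]] := f1.
by move=> x _ /=; rewrite lee_fin (ger0_norm (normc_ge0 _)) Re_le_normc.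
Qed.

Lemma cL1_Im f : cL1 f -> mu.-integrable [set: T] (EFin \o (fun x => complex.Im (f x))).
Proof.
move=> f1; apply: (le_integrable _ _ _ (cL1_normc f1)) => //.
  by apply/measurable_EFinP; have [[]] := f1.
by move=> x _ /=; rewrite lee_fin (ger0_norm (normc_ge0 _)) Im_le_normc.
Qed.

Lemma cL1_le f (h : T -> R) : cmfun f -> (forall x, N (f x) <= h x) ->
  mu.-integrable [set: T] (EFin \o h) -> cL1 f.
Proof.
move=> mf fh hi; split => //.
apply: (@le_lt_trans _ _ (\int[mu]_x `|(EFin \o h) x|)%E); last first.
  by case/integrableP : hi.
apply: ge0_le_integral => //.
- by move=> x _; rewrite lee_fin normc_ge0.
- by apply/measurable_EFinP; exact: measurable_normc.
- by apply: measurableT_comp => //; exact: measurable_int hi.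
- by move=> x _ /=; rewrite lee_fin (le_trans (fh x))// ler_norm.
Qed.

Lemma cL1Ml f g (M : R) : cmfun g -> (forall x, N (g x) <= M) -> cL1 f ->
  cL1 (fun x => g x * f x).
Proof.
move=> mg gM f1; apply: (@cL1_le _ (fun x => M * N (f x))).
- by apply: cmfunM => //; case: f1.
- by move=> x; rewrite Normc.normcM ler_wpM2r ?normc_ge0.
- exact: (integrableZl _ _ (cL1_normc f1)).
Qed.

Lemma cL1Z (c : R[i]) f : cL1 f -> cL1 (fun x => c * f x).
Proof. by move=> f1; apply: (cL1Ml (M := N c)) => //; exact: cmfun_cst. Qed.

Lemma cL1J f : cL1 f -> cL1 (fun x => conjc (f x)).
Proof.
move=> f1; apply: (@cL1_le _ (fun x => N (f x))).
- by apply: cmfunJ; case: f1.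
- by move=> x; rewrite normcJ.
- exact: cL1_normc.
Qed.

Lemma cintD f g : cL1 f -> cL1 g -> cint (fun x => f x + g x) = cint f + cint g.
Proof.
move=> f1 g1; rewrite /cint; simpc; congr Complex.
- rewrite -RintegralD//; try exact: cL1_Re.
  by apply: eq_Rintegral => x _; case: (f x) (g x) => a b [].
- rewrite -RintegralD//; try exact: cL1_Im.
  by apply: eq_Rintegral => x _; case: (f x) (g x) => a b [].
Qed.

Lemma cintZ (c : R[i]) f : cL1 f -> cint (fun x => c * f x) = c * cint f.
Proof.
move=> f1; have fr := cL1_Re f1; have fi := cL1_Im f1.
have Zi (k : R) (h : T -> R) : mu.-integrable [set: T] (EFin \o h) ->
   mu.-integrable [set: T] (EFin \o (fun x => k * h x)).
  by move=> hi; exact: (integrableZl _ _ hi).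
case: c => a b; rewrite /cint; simpc; congr Complex.
- rewrite -!RintegralZl// -RintegralB//; try exact: Zi.
  by apply: eq_Rintegral => x _; case: (f x).
- rewrite -!RintegralZl// -RintegralD//; try exact: Zi.
  by apply: eq_Rintegral => x _; case: (f x).
Qed.

Lemma cintB f g : cL1 f -> cL1 g -> cint (fun x => f x - g x) = cint f - cint g.
Proof.
move=> f1 g1; under [in LHS]eq_fun do rewrite -(mulN1r (g _)).
by rewrite cintD//; [rewrite cintZ// mulN1r|exact: cL1Z].
Qed.

Lemma cintJ f : cL1 f -> cint (fun x => conjc (f x)) = conjc (cint f).
Proof.
move=> f1; rewrite /cint; simpc; congr Complex.
  by apply: eq_Rintegral => x _; case: (f x).
rewrite -[RHS]mulN1r -RintegralZl//; last exact: cL1_Im.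
by apply: eq_Rintegral => x _; case: (f x) => a b /=; rewrite mulN1r.
Qed.

Lemma cint_real (h : T -> R) : cint (fun x => (h x)%:C) = (\int[mu]_x h x)%:C.
Proof.
rewrite /cint/=; congr Complex.
by rewrite /Rintegral integral0.
Qed.

(* The constant 2 is not optimal, but it spares the choice of a phase. *)
Lemma normc_cint f : cL1 f -> ((N (cint f))%:E <= 2%:E * \int[mu]_x (N (f x))%:E)%E.
Proof.
move=> f1; have fr := cL1_Re f1; have fi := cL1_Im f1.
have mN : measurable_fun [set: T] (fun x => (N (f x))%:E).
  by apply/measurable_EFinP/measurable_normc; case: f1.
have H (h : T -> R) : mu.-integrable [set: T] (EFin \o h) ->
    (forall x, `|h x| <= N (f x)) -> ((`|\int[mu]_x h x|)%:E <= \int[mu]_x (N (f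
        x))%:E)%E.
  move=> hi hf.
  rewrite EFin_normr_Rintegral//.
  apply: (le_trans (le_abse_integral _ _ _)) => //; first exact: measurable_int hi.
  apply: ge0_le_integral => //.
  - by apply: measurableT_comp => //; exact: measurable_int hi.
  - by move=> x _; rewrite lee_fin.
apply: (@le_trans _ _ (`|\int[mu]_x complex.Re (f x)| + `|\int[mu]_x complex.Im (f
    x)|)%:E).
  by rewrite lee_fin; exact: normc_le.
rewrite EFinD (_ : 2%:E = 1 + 1)%E// ge0_muleDl// !mul1e leeD//.
- by apply: H => // x; exact: Re_le_normc.
- by apply: H => // x; exact: Im_le_normc.
Qed.

Lemma eq_cint f g : f =1 g -> cint f = cint g.
Proof. by move=> /funext ->. Qed.

End complex_integral.

(** * Fubini's theorem for complex functions *)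

Section complex_fubini.
Context d1 d2 (T1 : measurableType d1) (T2 : measurableType d2) {R : realType}.
Context (m1 : {sigma_finite_measure set T1 -> \bar R}).
Context (m2 : {sigma_finite_measure set T2 -> \bar R}).
Local Notation N := (@Normc.normc R).

Lemma cmfun_comp (f : T2 -> R[i]) (h : T1 -> T2) :
  cmfun f -> measurable_fun [set: T1] h -> cmfun (fun x => f (h x)).
Proof.
move=> [fr fi] mh; split.
- exact: (measurableT_comp fr).
- exact: (measurableT_comp fi).
Qed.

(** Integrability of every slice makes each inner integral finite, so the [fine] hidden in
    [Rintegral] loses nothing and the extended-real theorem applies to the real and imaginary
    parts. *)
Lemma cint_fubini (k : T1 * T2 -> R[i]) :
  cmfun k -> (\int[m1]_x \int[m2]_y (N (k (x, y)))%:E < +oo)%E ->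
  (forall x, cL1 m2 (fun y => k (x, y))) -> (forall y, cL1 m1 (fun x => k (x, y))) ->
  cint m1 (fun x => cint m2 (fun y => k (x, y))) =
  cint m2 (fun y => cint m1 (fun x => k (x, y))).
Proof.
move=> mk ky k2 k1.
have H (h : T1 * T2 -> R) : measurable_fun setT h -> (forall p, `|h p| <= N (k p)) ->
   (forall x, m2.-integrable [set: T2] (EFin \o (fun y => h (x, y)))) ->
   (forall y, m1.-integrable [set: T1] (EFin \o (fun x => h (x, y)))) ->
  \int[m1]_x \int[m2]_y h (x, y) = \int[m2]_y \int[m1]_x h (x, y).
  move=> mh hk h2 h1.
  rewrite {1}/Rintegral [RHS]/Rintegral; congr fine.
  transitivity (\int[m1]_x \int[m2]_y (h (x, y))%:E)%E.
    by apply: eq_integral => x _; rewrite /Rintegral fineK//; apply: integrable_fin_num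
        => //; exact: h2.
  transitivity (\int[m2]_y \int[m1]_x (h (x, y))%:E)%E; last first.
    by apply: eq_integral => x _; rewrite /Rintegral fineK//; apply: integrable_fin_num
        => //; exact: h1.
  apply: (@Fubini _ _ _ _ _ _ _ (EFin \o h)).
  apply/integrable12ltyP; first exact/measurable_EFinP.
  apply: le_lt_trans ky; apply: ge0_le_integral => //.
  - by move=> x _; apply: integral_ge0.
  - apply: (measurable_fun_fubini_tonelli_F (fun p => `|(EFin \o h) p|%E)) => //=.
    by apply/measurable_EFinP; exact: measurableT_comp.
  - apply: (measurable_fun_fubini_tonelli_F (fun p => (N (k p))%:E)) => //=.
      by apply/measurable_EFinP; exact: measurable_normc.
    by move=> p; rewrite lee_fin normc_ge0.
  - move=> x _; apply: ge0_le_integral => //.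
    + by have /measurable_int := h2 x; exact: measurableT_comp.
    + by apply/measurable_EFinP/measurable_normc; case: (k2 x).
    + by move=> y _; rewrite lee_fin.
rewrite /cint/=; congr Complex.
- apply: (H (fun p => complex.Re (k p))).
  + by case: mk.
  + by move=> p; exact: Re_le_normc.
  + by move=> x; exact: cL1_Re.
  + by move=> x; exact: cL1_Re.
- apply: (H (fun p => complex.Im (k p))).
  + by case: mk.
  + by move=> p; exact: Im_le_normc.
  + by move=> x; exact: cL1_Im.
  + by move=> x; exact: cL1_Im.
Qed.

(** Tonelli's measurability statement is about nonnegative integrands, hence the split into positive
    and negative parts; composition with the measurable [fine] covers slices whose integral is
    infinite. *)
Lemma cmfun_cint (k : T1 * T2 -> R[i]) : cmfun k ->
  cmfun (fun x => cint m2 (fun y => k (x, y))).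
Proof.
move=> mk.
have H (h : T1 * T2 -> R) : measurable_fun setT h ->
    measurable_fun [set: T1] (fun x => \int[m2]_y h (x, y)).
  move=> mh; rewrite /Rintegral.
  apply: (measurableT_comp (@fine_measurable R setT measurableT)) => /=.
  have -> : (fun x => \int[m2]_y (h (x, y))%:E)%E =
    (fun x => \int[m2]_y ((EFin \o h)^\+ (x, y)) - \int[m2]_y ((EFin \o h)^\- (x, y)))%E.
    by apply/funext => x; rewrite [LHS]integralE; congr (_ - _)%E;
      apply: eq_integral => y _; rewrite !(funeposE, funenegE).
  apply: emeasurable_funB.
  - apply: (measurable_fun_fubini_tonelli_F (EFin \o h)^\+)%E => //.
    by apply: measurable_funepos; exact/measurable_EFinP.
  - apply: (measurable_fun_fubini_tonelli_F (EFin \o h)^\-)%E => //.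
    by apply: measurable_funeneg; exact/measurable_EFinP.
case: mk => kr ki; split.
- exact: (H (fun p => complex.Re (k p))).
- exact: (H (fun p => complex.Im (k p))).
Qed.

End complex_fubini.

(** * Changes of variables for signed and complex integrals *)

Section rV_transfer.
Context {R : realType} {d : nat}.
Local Notation mu := (@lebesgue_rV R d : {measure set 'rV[R]_d -> \bar R}).
Local Notation N := (@Normc.normc R).

Lemma integral_rV_shift (v : 'rV[R]_d) (f : 'rV[R]_d -> \bar R) :
  measurable_fun [set: _] f ->
  (\int[mu]_x f (x + v)%R = \int[mu]_x f x)%E.
Proof.
move=> mf; rewrite [LHS]integralE [RHS]integralE; congr (_ - _)%E.
- rewrite -[RHS](ge0_integral_rV_shift v)//; last exact: measurable_funepos.
  by apply: eq_integral => x _; rewrite !funeposE.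
- rewrite -[RHS](ge0_integral_rV_shift v)//; last exact: measurable_funeneg.
  by apply: eq_integral => x _; rewrite !funenegE.
Qed.

Lemma Rintegral_rV_scale (c : R) (f : 'rV[R]_d -> R) : 0 < c ->
  mu.-integrable [set: _] (EFin \o f) ->
  c ^+ d * (\int[mu]_x f (c *: x)) = \int[mu]_x f x.
Proof.
move=> c0 fi.
have mf := measurable_int _ fi.
have cd0 : c ^+ d != 0 by rewrite expf_neq0// gt_eqF.
have E (g : 'rV[R]_d -> \bar R) : (forall x, 0 <= g x)%E -> measurable_fun [set: _] g ->
    (\int[mu]_x g (c *: x) = (c ^+ d)^-1%:E * \int[mu]_x g x)%E.
  move=> g0 mg; rewrite -(ge0_integral_rV_scale c0 mg)// muleA -EFinM mulVf//.
  by rewrite mul1e.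
rewrite /Rintegral integralE [in RHS]integralE.
have -> : (\int[mu]_x (fun x => (f (c *: x))%:E)^\+ x = (c ^+ d)^-1%:E * \int[mu]_x
    ((EFin \o f)^\+ x))%E.
  rewrite -E//; last exact: measurable_funepos.
  by apply: eq_integral => x _; rewrite !funeposE.
have -> : (\int[mu]_x (fun x => (f (c *: x))%:E)^\- x = (c ^+ d)^-1%:E * \int[mu]_x
    ((EFin \o f)^\- x))%E.
  rewrite -E//; last exact: measurable_funeneg.
  by apply: eq_integral => x _; rewrite !funenegE.
have p1 := integrable_pos_fin_num measurableT fi.
have n1 := integrable_neg_fin_num measurableT fi.
rewrite -(fineK p1) -(fineK n1) -!EFinM -!EFinB /= -mulrBr mulrA divff//.
by rewrite mul1r.
Qed.

Lemma cintegral_shift (v : 'rV[R]_d) (f : 'rV[R]_d -> R[i]) : cmeasurable f ->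
  cintegral (fun x => f (x + v)) = cintegral f.
Proof.
move=> [mr mi]; rewrite /cintegral /Rintegral; congr Complex; congr fine.
- apply: (@integral_rV_shift v (fun x => (complex.Re (f x))%:E)).
  exact/measurable_EFinP.
- apply: (@integral_rV_shift v (fun x => (complex.Im (f x))%:E)).
  exact/measurable_EFinP.
Qed.

End rV_transfer.

(** * The damping factor and the Poisson kernel in dimension d *)

Section kernel.
Context {R : realType}.
Local Notation mu d := (@lebesgue_rV R d : {measure set 'rV[R]_d -> \bar R}).
Local Notation N := (@Normc.normc R).

(** Damping by the sum of the |x_i| and not by the Euclidean norm: the product form lets transforms
    be computed one coordinate at a time. Being positive, integrable and at most 1, [gam] also
    serves as a weight in test functions. *)
Definition gam d (x : 'rV[R]_d) : R := \prod_(i < d) gam1 (x ord0 i).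

Definition pk d (x : 'rV[R]_d) : R := \prod_(i < d) pk1 (x ord0 i).

Lemma gamS d (x : 'rV[R]_d.+1) :
  gam x = gam1 (rV_uncons x).1 * gam (rV_uncons x).2.
Proof.
rewrite /gam big_ord_recl/=; congr (_ * _).
by apply: eq_bigr => i _; rewrite mxE.
Qed.

Lemma pkS d (x : 'rV[R]_d.+1) :
  pk x = pk1 (rV_uncons x).1 * pk (rV_uncons x).2.
Proof.
rewrite /pk big_ord_recl/=; congr (_ * _).
by apply: eq_bigr => i _; rewrite mxE.
Qed.

Lemma gam_gt0 d (x : 'rV[R]_d) : 0 < gam x.
Proof. by apply: prodr_gt0 => i _; exact: expR_gt0. Qed.

Lemma gam_le1 d (x : 'rV[R]_d) : gam x <= 1.
Proof.
have <- : \prod_(i < d) (1 : R) = 1 by rewrite big1_eq.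
apply: ler_prod => i _; rewrite gam1_ge0/= /gam1 expR_le1.
by rewrite oppr_le0 !mulr_ge0// pi_ge0.
Qed.

Lemma pk_ge0 d (x : 'rV[R]_d) : 0 <= pk x.
Proof. by apply: prodr_ge0 => i _; exact: pk1_ge0. Qed.

Lemma pkN d (x : 'rV[R]_d) : pk (- x) = pk x.
Proof. by apply: eq_bigr => i _; rewrite mxE /pk1 sqrrN. Qed.

Lemma measurable_gam d : measurable_fun [set: 'rV[R]_d] (@gam d).
Proof.
apply: measurable_prod => i _.
apply: (measurableT_comp measurable_gam1); exact: (@measurable_rV_coord _ R).
Qed.

Lemma measurable_pk d : measurable_fun [set: 'rV[R]_d] (@pk d).
Proof.
apply: measurable_prod => i _.
apply: (measurableT_comp measurable_pk1); exact: (@measurable_rV_coord _ R).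
Qed.

Lemma lebesgue_rV0T : (@lebesgue_rV R 0) [set: _] = 1%E.
Proof. by rewrite /= diracE mem_set. Qed.

Lemma integral_rV0 (c : R) : (\int[mu 0]_x c = c)%R.
Proof.
rewrite /Rintegral integral_cst//.
by rewrite [X in fine (_ * X)](_ : _ = 1%E) ?mule1//; exact: lebesgue_rV0T.
Qed.

Lemma integrable_rV0 (f : 'rV[R]_0 -> R) : (mu 0).-integrable [set: _] (EFin \o f).
Proof.
rewrite (_ : EFin \o f = cst (f 0)%:E).
  apply/integrableP; split; first exact: measurable_cst.
  rewrite integral_cst//.
  by rewrite [X in (_ * X)%E](_ : _ = 1%E) ?mule1 ?ltry//; exact: lebesgue_rV0T.
by apply/funext => x /=; rewrite [x]thinmx0.
Qed.

Lemma Rintegral_pk1 : (\int[@lebesgue_measure R]_x pk1 x = 1)%R.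
Proof. by rewrite /Rintegral ge0_integral_pk1. Qed.

Lemma integrable_pk1 : (@lebesgue_measure R).-integrable [set: _] (EFin \o pk1).
Proof.
apply/integrableP; split.
  by apply/measurable_EFinP; exact: measurable_pk1.
under eq_integral => x _ do rewrite /= ger0_norm ?pk1_ge0//.
by rewrite ge0_integral_pk1 ltry.
Qed.

Lemma integral_pk d : (mu d).-integrable [set: _] (EFin \o @pk d) /\
  (\int[mu d]_x pk x = 1)%R.
Proof.
elim: d => [|d [ih1 ih2]].
  split; first exact: integrable_rV0.
  rewrite -[RHS]integral_rV0; apply: eq_Rintegral => x _.
  by rewrite /pk big_ord0.
have [i1 i2] := integral_rV_tensor integrable_pk1 ih1; split.
  apply: eq_integrable i1 => //.
  by move=> x _; rewrite [in RHS]/comp pkS.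
move: i2; rewrite Rintegral_pk1 ih2 mulr1 => <-.
by apply: eq_Rintegral => x _; rewrite pkS.
Qed.

Lemma dotpS d (v x : 'rV[R]_d.+1) : dotp v x =
  (rV_uncons v).1 * (rV_uncons x).1 + dotp (rV_uncons v).2 (rV_uncons x).2.
Proof.
rewrite /dotp big_ord_recl/=; congr (_ + _).
by apply: eq_bigr => i _; rewrite !mxE.
Qed.

Lemma measurable_dotp d (v : 'rV[R]_d) : measurable_fun [set: 'rV[R]_d] (dotp v).
Proof.
apply: measurable_sum => i; apply: measurable_funM => //.
exact: (@measurable_rV_coord _ R).
Qed.

(** The addition formulas mix the cosines and sines of the first coordinate and of the others, so
    all five facts go through the induction together. Every product containing a sine integral
    vanishes, which leaves the product of the cosine integrals. *)
Lemma integral_gam_cos_sin d (v : 'rV[R]_d) :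
  [/\ (mu d).-integrable [set: _] (EFin \o @gam d),
      (mu d).-integrable [set: _] (EFin \o (fun x => gam x * cos (2 * pi * dotp v x))),
      (mu d).-integrable [set: _] (EFin \o (fun x => gam x * sin (2 * pi * dotp v x))),
      (\int[mu d]_x (gam x * cos (2 * pi * dotp v x)) = pk v)%R &
      (\int[mu d]_x (gam x * sin (2 * pi * dotp v x)) = 0)%R].
Proof.
elim: d v => [|d ih] v.
  split; try exact: integrable_rV0.
    rewrite /pk big_ord0 -[RHS]integral_rV0; apply: eq_Rintegral => x _.
    by rewrite /gam /dotp !big_ord0 mulr0 cos0 mulr1.
  rewrite -[RHS]integral_rV0; apply: eq_Rintegral => x _.
  by rewrite /gam /dotp !big_ord0 mulr0 sin0 mulr0.
have [ig ic is_ ec es] := ih (rV_uncons v).2.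
set a := (rV_uncons v).1.
have mc : measurable_fun [set: R] (fun x => cos (2 * pi * (a * x))).
  apply: (measurableT_comp (continuous_measurable_fun (@continuous_cos R))).
  by apply: measurable_funM => //; exact: measurable_funM.
have ms : measurable_fun [set: R] (fun x => sin (2 * pi * (a * x))).
  apply: (measurableT_comp (continuous_measurable_fun (@continuous_sin R))).
  by apply: measurable_funM => //; exact: measurable_funM.
have c1 : (@lebesgue_measure R).-integrable setT (EFin \o (fun x => gam1 x * cos (2 *
    pi * (a * x)))).
  by apply: integrable_gam1M => // x; rewrite ler_norml cos_geN1 cos_le1.
have s1 : (@lebesgue_measure R).-integrable setT (EFin \o (fun x => gam1 x * sin (2 *
    pi * (a * x)))).
  by apply: integrable_gam1M => // x; rewrite ler_norml sin_geN1 sin_le1.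
have [g1 _] := integral_rV_tensor integrable_gam1 ig.
have [cc1 cc2] := integral_rV_tensor c1 ic.
have [cs1 cs2] := integral_rV_tensor c1 is_.
have [sc1 sc2] := integral_rV_tensor s1 ic.
have [ss1 ss2] := integral_rV_tensor s1 is_.
have Ec : (fun x => gam x * cos (2 * pi * dotp v x)) = (fun x : 'rV[R]_d.+1 =>
    gam1 (rV_uncons x).1 * cos (2 * pi * (a * (rV_uncons x).1)) *
     (gam (rV_uncons x).2 * cos (2 * pi * dotp (rV_uncons v).2 (rV_uncons x).2)) -
    gam1 (rV_uncons x).1 * sin (2 * pi * (a * (rV_uncons x).1)) *
     (gam (rV_uncons x).2 * sin (2 * pi * dotp (rV_uncons v).2 (rV_uncons x).2))).
  by apply/funext => x; rewrite gamS dotpS mulrDr cosD -/a; ring.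
have Es : (fun x => gam x * sin (2 * pi * dotp v x)) = (fun x : 'rV[R]_d.+1 =>
    gam1 (rV_uncons x).1 * sin (2 * pi * (a * (rV_uncons x).1)) *
     (gam (rV_uncons x).2 * cos (2 * pi * dotp (rV_uncons v).2 (rV_uncons x).2)) +
    gam1 (rV_uncons x).1 * cos (2 * pi * (a * (rV_uncons x).1)) *
     (gam (rV_uncons x).2 * sin (2 * pi * dotp (rV_uncons v).2 (rV_uncons x).2))).
  by apply/funext => x; rewrite gamS dotpS mulrDr sinD -/a; ring.
split.
- apply: eq_integrable g1 => //.
  by move=> x _; rewrite [in RHS]/comp gamS.
- rewrite Ec; exact: (integrableB _ cc1 ss1).
- rewrite Es; exact: (integrableD _ sc1 cs1).
- rewrite Ec RintegralB// cc2 ss2 ec es integral_gam1_cos pkS.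
  by rewrite mulr0 subr0.
- rewrite Es RintegralD// sc2 cs2 ec es integral_gam1_sin.
  by rewrite mulr0 mul0r addr0.
Qed.

Lemma integrable_gam d : (mu d).-integrable [set: _] (EFin \o @gam d).
Proof. by have [] := integral_gam_cos_sin (0 : 'rV[R]_d). Qed.

End kernel.

(** * Continuity of translations in L^1 *)

Section ereal_cvg0.
Context {R : realType}.
Local Open Scope ereal_scope.

Lemma cvge0P (u : (\bar R)^nat) : (forall n, 0 <= u n) ->
  (u @ \oo --> 0) <-> (forall e : R, (0 < e)%R -> \forall n \near \oo, u n < e%:E).
Proof.
move=> u0; split.
  move=> /fine_cvgP[ufin /cvgr0Pnorm_lt ul] e e0.
  near=> n.
  have un : u n \is a fin_num by near: n.
  rewrite -(fineK un) lte_fin -[ltLHS]ger0_norm ?fine_ge0//.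
  by near: n; exact: ul.
move=> ul; apply/fine_cvgP; split.
  near=> n; rewrite ge0_fin_numE//; apply: (@lt_trans _ _ 1%:E); last exact: ltry.
  by near: n; exact: ul.
apply/cvgr0Pnorm_lt => e e0; near=> n.
have une : u n < e%:E by near: n; exact: ul.
have un : u n \is a fin_num by rewrite ge0_fin_numE// (lt_trans une)// ltry.
by rewrite /= ger0_norm ?fine_ge0// -lte_fin fineK.
Unshelve. all: by end_near. Qed.

Lemma cvge0_le (u v : (\bar R)^nat) : (forall n, 0 <= u n <= v n) ->
  v @ \oo --> 0 -> u @ \oo --> 0.
Proof.
move=> uv v0; apply: (@squeeze_cvge _ _ _ _ (cst 0) _ v) => //.
  by near=> n; exact: uv.
exact: cvg_cst.
Unshelve. all: by end_near. Qed.

Lemma cvge0D (u v : (\bar R)^nat) : u @ \oo --> 0 -> v @ \oo --> 0 ->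
  (fun n => u n + v n) @ \oo --> 0.
Proof. by move=> u0 v0; rewrite -[X in _ --> X]adde0; exact: cvgeD. Qed.

Lemma cvge0Z (c : R) (u : (\bar R)^nat) : u @ \oo --> 0 ->
  (fun n => c%:E * u n) @ \oo --> 0.
Proof. by move=> u0; rewrite -[X in _ --> X](mule0 c%:E); exact: cvgeZl. Qed.

Lemma dominated_cvge0 d (T : measurableType d) (mu : {measure set T -> \bar R})
  (A : nat -> T -> \bar R) (G : T -> \bar R) :
  (forall n, measurable_fun [set: T] (A n)) -> mu.-integrable [set: T] G ->
  (forall n x, 0 <= A n x <= G x) -> {ae mu, forall x, A ^~ x @ \oo --> 0} ->
  (fun n => \int[mu]_x A n x) @ \oo --> 0.
Proof.
move=> mA iG AG A0.
have [||||_ _] := @dominated_convergence _ _ _ mu _ measurableT A (cst 0) G mA.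
- exact: measurable_cst.
- by apply: filterS A0 => x Ax _.
- exact: iG.
- apply: nearW => x n _.
  by have /andP[A1 A2] := AG n x; rewrite gee0_abs.
by rewrite integral0.
Qed.

End ereal_cvg0.

Section translation1.
Context {R : realType}.
Local Notation leb := (@lebesgue_measure R).

Lemma measurable_shift1 (f : R -> R) (a : R) : measurable_fun [set: R] f ->
  measurable_fun [set: R] (fun x => f (x + a)).
Proof.
by move=> mf; apply: (measurableT_comp mf); apply: measurable_funD.
Qed.

(** Dominated convergence. The truncated function can jump only at the two endpoints, a null set,
    and all differences live in the interval enlarged by [|t|], where they are bounded by twice the
    maximum of [|c|]. *)
Lemma cvg_L1_shift1_indic (c : R -> R) (M t : R) : 0 <= M -> continuous c ->
  (fun n => \int[leb]_x `|((c \_ [set` `[- M, M]%R]) (x + n.+1%:R^-1 * t) - (c \_ [set`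
      `[- M, M]%R]) x)%:E|)%E
    @ \oo --> 0%E.
Proof.
move=> M0 cc; set E : set R := [set` `[- M, M]%R].
have mE : measurable E by exact: measurable_itv.
have [B B0 cB] : exists2 B, 0 <= B & forall x : R, E x -> `|c x| <= B.
  have := @segment_compact _ (- M) M.
  move=> /(continuous_compact (continuous_subspaceT cc)) /compact_bounded[B [_ HB]].
  exists (`|B| + 1) => [|x Ex]; first by rewrite addr_ge0.
  apply: (HB (`|B| + 1)) => //; first by rewrite ltr_pwDr// ler_norm.
have kB (x : R) : `|(c \_ E) x| <= B.
  by rewrite /patch; case: ifPn => [/set_mem/cB//|]; rewrite normr0.
have mk : measurable_fun [set: R] (c \_ E).
  apply/(measurable_restrictT c) => //.
  by apply: measurable_funTS; exact: continuous_measurable_fun.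
pose L := M + `|t|.
apply: (@dominated_cvge0 R _ (measurableTypeR R) (@lebesgue_measure R) (fun n x =>
    `|((c \_ E) (x + n.+1%:R^-1 * t) - (c \_ E) x)%:E|%E)
  (fun x => (2 * B)%:E * (\1_([set` `[- L, L]%R] : set R) x)%:E)%E).
- move=> n; apply: measurableT_comp => //; apply/measurable_EFinP.
  by apply: measurable_funB => //; exact: measurable_shift1.
- apply: integrableZl => //; exact: integrable_indic_itv.
- move=> n x; rewrite abse_ge0/=.
  have rt : `|n.+1%:R^-1 * t| <= `|t|.
    by rewrite normrM ler_piMl// ger0_norm// invf_le1// ler1n.
  have [xL|xL] := pselect ([set` `[- L, L]%R] x).
    rewrite indicE mem_set// mule1 lee_fin.
    by rewrite (le_trans (ler_normB _ _))// mulr_natl mulr2n lerD.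
  suff out y : `|y - x| <= `|t| -> (c \_ E) y = 0.
    have -> : (c \_ E) (x + n.+1%:R^-1 * t) = 0.
      by apply: out; rewrite addrAC subrr add0r.
    have -> : (c \_ E) x = 0 by apply: out; rewrite subrr normr0.
    by rewrite subrr normr0 -EFinM lee_fin mulr_ge0// mulr_ge0.
  move=> yx; rewrite /patch memNset// /E/= in_itv/= => /andP[y1 y2].
  apply: xL; rewrite /= in_itv/= /L.
  move: yx; rewrite ler_norml => /andP[? ?]; apply/andP; split; lra.
- have n1 a : (@lebesgue_measure R).-negligible ([set a] : set (measurableTypeR R)).
    apply/negligibleP; first exact: measurable_set1.
    exact: lebesgue_measure_set1.
  apply: (negligibleS _ (negligibleU (n1 M) (n1 (- M)))) => x /= H.
  apply: contrapT => /not_orP[xM xNM]; apply: H.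
  have ck : {for x, continuous (c \_ E)}.
    have [xE|xE] := pselect (E x).
      have xo : `]- M, M[%classic x.
        move: xE; rewrite /E /= !in_itv/= => /andP[x1 x2].
        by rewrite !lt_neqAle x1 x2 !andbT; apply/andP; split; apply/eqP => // /esym.
      have nx : \forall y \near x, c y = (c \_ E) y.
        have : nbhs x `]- M, M[%classic by apply: open_nbhs_nbhs; split => //; exact:
            itv_open.
        apply: filterS => y; rewrite /= in_itv/= => /andP[y1 y2].
        by rewrite /patch mem_set// /E/= in_itv/= !ltW.
      apply: (@cvg_trans _ (c y @[y --> x])).
        exact: near_eq_cvg.
      rewrite (_ : (c \_ E) x = c x); last by rewrite /patch mem_set.
      exact: cc.
    have nx : \forall y \near x, 0 = (c \_ E) y.
      have : nbhs x (~` E).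
        apply: open_nbhs_nbhs; split => //; rewrite openC; exact: itv_closed.
      by apply: filterS => y yE; rewrite /patch memNset.
    apply: (@cvg_trans _ ((fun=> 0) y @[y --> x])).
      exact: near_eq_cvg.
    rewrite (_ : (c \_ E) x = 0); last by rewrite /patch memNset.
    exact: (@cst_continuous R R 0 x).
  have sx : (fun n => x + n.+1%:R^-1 * t) @ \oo --> x.
    rewrite -[X in _ --> X]addr0; apply: cvgD; first exact: cvg_cst.
    rewrite -(mul0r t); apply: cvgM; [exact: cvg_harmonic|exact: cvg_cst].
  have : (fun n => (c \_ E) (x + n.+1%:R^-1 * t) - (c \_ E) x) @ \oo --> (0 : R).
    rewrite -(subrr ((c \_ E) x)); apply: cvgB; last exact: cvg_cst.
    exact: (cvg_comp _ _ sx ck).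
  move=> /cvgr0Pnorm_lt H0; apply/cvge0P => [n|e e0]; first by rewrite lee_fin.
  by have := H0 _ e0; apply: filterS => n /=; rewrite lte_fin.
Qed.

(** Replacing [f] by [g] costs one error at x and one at x + s; by shift invariance they have the
    same integral, whence the factor 2. *)
Lemma integral_normB_shift1 (f g : R -> R) (s : R) :
  measurable_fun [set: R] f -> measurable_fun [set: R] g ->
  (\int[leb]_x `|(f (x + s) - f x)%:E| <= \int[leb]_x `|(g (x + s) - g x)%:E| +
     2%:E * \int[leb]_x `|(g x - f x)%:E|)%E.
Proof.
move=> mf mg.
have mN (h : R -> R) : measurable_fun [set: R] h ->
    measurable_fun [set: R] (fun x => `|(h x)%:E|)%E.
  by move=> mh; apply: measurableT_comp => //; exact/measurable_EFinP.
have mgf : measurable_fun [set: R] (fun x => g x - f x) by exact: measurable_funB.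
have -> : (2%:E * \int[leb]_x `|(g x - f x)%:E| =
   \int[leb]_x `|(g (x + s) - f (x + s))%:E| + \int[leb]_x `|(g x - f x)%:E|)%E.
  rewrite (@ge0_integral_shift _ _ (fun x => `|(g x - f x)%:E|)%E)//.
    by rewrite (_ : 2%:E = 1 + 1)%E// ge0_muleDl// !mul1e.
  exact: mN.
rewrite -ge0_integralD//; last 2 first.
- by apply: mN; exact: (measurable_shift1 _ mgf).
- exact: mN.
rewrite -ge0_integralD//; last 3 first.
- by apply: mN; apply: measurable_funB => //; exact: measurable_shift1.
- by move=> x _; exact: adde_ge0.
- apply: emeasurable_funD; last exact: mN.
  by apply: mN; exact: (measurable_shift1 _ mgf).
apply: ge0_le_integral => //.
- by apply: mN; apply: measurable_funB => //; exact: measurable_shift1.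
- apply: emeasurable_funD.
    by apply: mN; apply: measurable_funB => //; exact: measurable_shift1.
  apply: emeasurable_funD; last exact: mN.
  by apply: mN; exact: (measurable_shift1 _ mgf).
move=> x _; rewrite -!EFinD lee_fin.
rewrite (_ : f (x + s) - f x = (g (x + s) - g x) + ((g x - f x) - (g (x + s) - f (x +
    s)))); last by ring.
rewrite (le_trans (ler_normD _ _))// lerD2l addrC.
by rewrite (le_trans (ler_normB _ _))// addrC.
Qed.

Lemma cvg_L1_shift1 (f : R -> R) (t : R) : leb.-integrable [set: _] (EFin \o f) ->
  (fun n => \int[leb]_x `|(f (x + n.+1%:R^-1 * t) - f x)%:E|)%E @ \oo --> 0%E.
Proof.
move=> fi.
have mf : measurable_fun [set: R] f by apply/measurable_EFinP; exact: measurable_int fi.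
apply/cvge0P => [n|e e0]; first exact: integral_ge0.
(* Truncation to [-N, N] and the continuous approximation cost e/6 each, both counted twice by
   [integral_normB_shift1]; the shift of the approximant costs another e/6. The total is 5e/6. *)
have e6 : 0 < e / 6 by rewrite divr_gt0.
pose I (n : nat) := (`[- n%:R, n%:R]%classic : set R).
have mI n : measurable (I n) by exact: measurable_itv.
have [N fN] : exists n, (\int[leb]_x `|((f \_ (I n)) x - f x)%:E| < (e / 6)%:E)%E.
  have [|||||_ + _] := @dominated_convergence _ _ _ leb _ measurableT
    (fun n => EFin \o (f \_ (I n))) (EFin \o f) (abse \o (EFin \o f)).
  - by move=> n; apply/measurable_EFinP/(measurable_restrictT f) => //; exact:
      measurable_funTS.
  - exact/measurable_EFinP.
  - apply: nearW => x _; apply: cvg_near_cst.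
    near=> n; rewrite /= /patch mem_set// /I/= in_itv/= -ler_norml.
    by near: n; exact: nbhs_infty_ger.
  - exact: integrable_abse.
  - apply: nearW => x n _ /=; rewrite lee_fin /patch.
    by case: ifPn => //; rewrite normr0.
  move/cvge0P => H; have {H} := H _ _ e6 => H.
  have [n|k _ H2] := H; first exact: integral_ge0.
  by exists k; exact: (H2 k (leqnn k)).
have [||g_ [cg gi gl]] := @approximation_continuous_integrable R (I N) f (mI N).
- rewrite [X in (X < _)%E](lebesgue_measure_itv `[- N%:R, N%:R]%R)/=.
  by case: ifP => _; rewrite -?EFinB ltry.
- by apply: integrableS fi => //; exact: mI.
have {gl}[m fg] : exists m, (\int[leb]_(x in I N) `|(f x - g_ m x)%:E| < (e / 6)%:E)%E.
  move/cvge0P : gl => H; have {H} := H _ _ e6 => H.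
  have [n|k _ H2] := H; first exact: integral_ge0.
  by exists k; exact: (H2 k (leqnn k)).
pose k := g_ m \_ (I N).
have mg : measurable_fun [set: R] (g_ m) by exact: continuous_measurable_fun.
have mk : measurable_fun [set: R] k.
  by apply/(measurable_restrictT (g_ m)) => //; exact: measurable_funTS.
have mfN : measurable_fun [set: R] (f \_ (I N)).
  by apply/(measurable_restrictT f) => //; exact: measurable_funTS.
have mN (h : R -> R) : measurable_fun [set: R] h ->
    measurable_fun [set: R] (fun x => `|(h x)%:E|)%E.
  by move=> mh; apply: measurableT_comp => //; exact/measurable_EFinP.
have kf : (\int[leb]_x `|(k x - f x)%:E| <= (e / 6 + e / 6)%:E)%E.
  apply: (@le_trans _ _ (\int[leb]_x (`|(k x - (f \_ (I N)) x)%:E| + `|((f \_ (I N)) x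
      - f x)%:E|))%E).
    apply: ge0_le_integral => //.
    - by apply: mN; exact: measurable_funB.
    - by apply: emeasurable_funD; apply: mN; exact: measurable_funB.
    - by move=> x _; rewrite -EFinD lee_fin ler_distD.
  rewrite ge0_integralD//; last 2 first.
  - by apply: mN; exact: measurable_funB.
  - by apply: mN; exact: measurable_funB.
  rewrite EFinD leeD//; last exact: ltW.
  move/ltW : fg; apply: le_trans.
  rewrite [leRHS]integral_mkcond le_eqVlt; apply/orP; left; apply/eqP.
  apply: eq_integral => x _; rewrite /patch /k /patch.
  by case: ifPn => _ /=; [rewrite distrC|rewrite subrr normr0].
have := @cvg_L1_shift1_indic (g_ m) N%:R t (ler0n _ _) (cg m).
move/cvge0P => H; have {H} := H _ _ e6 => H.
have {}H := H (fun n => integral_ge0 _ _).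
near=> n.
apply: (le_lt_trans (@integral_normB_shift1 f k (n.+1%:R^-1 * t) mf mk)).
apply: (@le_lt_trans _ _ ((e / 6)%:E + 2%:E * (e / 6 + e / 6)%:E)%E).
  apply: leeD; last by rewrite lee_pmul2l.
  by apply: ltW; near: n; apply: H => n x _; exact: abse_ge0.
rewrite -EFinM -EFinD lte_fin; lra.
Unshelve. all: by end_near. Qed.

End translation1.

Section translation.
Context {R : realType}.
Local Notation leb := (@lebesgue_measure R).
Local Notation mu d := (@lebesgue_rV R d : {measure set 'rV[R]_d -> \bar R}).
Local Open Scope ereal_scope.

Lemma integral_normB_le d (T : measurableType d) (m : {measure set T -> \bar R})
    (f g : T -> R) :
  measurable_fun [set: T] f -> measurable_fun [set: T] g ->
  \int[m]_x `|(g x - f x)%:E| <= \int[m]_x `|(g x)%:E| + \int[m]_x `|(f x)%:E|.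
Proof.
move=> mf mg.
have mN (h : T -> R) : measurable_fun [set: T] h ->
    measurable_fun [set: T] (fun x => `|(h x)%:E|).
  by move=> mh; apply: measurableT_comp => //; exact/measurable_EFinP.
rewrite -ge0_integralD//; try exact: mN.
apply: ge0_le_integral => //.
- by apply: mN; exact: measurable_funB.
- by apply: emeasurable_funD; exact: mN.
- by move=> x _; rewrite -EFinD lee_fin ler_normB.
Qed.

Lemma integral_normB_shift1_le (f : R -> R) (a : R) : measurable_fun [set: R] f ->
  \int[leb]_x `|(f (x + a) - f x)%:E| <= 2%:E * \int[leb]_x `|(f x)%:E|.
Proof.
move=> mf.
apply: (le_trans (@integral_normB_le _ (measurableTypeR R) (@lebesgue_measure R) _ _ mf
    (measurable_shift1 a mf))).
rewrite (@ge0_integral_shift _ _ (fun x => `|(f x)%:E|))//.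
  by rewrite (_ : 2%:E = 1 + 1)%E// ge0_muleDl//; rewrite ?mul1e; first exact: lexx.
by apply: measurableT_comp => //; exact/measurable_EFinP.
Qed.

Lemma integral_normB_rV_shift_le d (f : 'rV[R]_d -> R) (v : 'rV[R]_d) :
  measurable_fun [set: _] f ->
  \int[mu d]_x `|(f (x + v)%R - f x)%:E| <= 2%:E * \int[mu d]_x `|(f x)%:E|.
Proof.
move=> mf.
have ms := measurableT_comp mf (measurable_rV_shift v).
apply: (le_trans (integral_normB_le _ mf ms)).
rewrite (@ge0_integral_rV_shift _ _ v (fun x => `|(f x)%:E|))//.
  by rewrite (_ : 2%:E = 1 + 1)%E// ge0_muleDl//; rewrite ?mul1e; first exact: lexx.
by apply: measurableT_comp => //; exact/measurable_EFinP.
Qed.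

(** Induction on the dimension. The shift is split into one of the first coordinate and one of the
    others. Almost every slice is integrable, so the one-dimensional case and the induction
    hypothesis give convergence on slices, and twice the L^1 norm of the slice dominates. *)
Lemma cvg_L1_shift d (f : 'rV[R]_d -> R) (t : 'rV[R]_d) :
  (mu d).-integrable [set: _] (EFin \o f) ->
  (fun n => \int[mu d]_x `|(f (x + n.+1%:R^-1 *: t)%R - f x)%:E|) @ \oo --> 0.
Proof.
elim: d f t => [|d ih] f t fi.
  rewrite (_ : (fun _ => _) = cst 0); first exact: cvg_cst.
  apply/funext => n; apply: integral0_eq => x _.
  by rewrite [t]thinmx0 scaler0 addr0 subrr /= normr0.
have mf : measurable_fun [set: _] f by apply/measurable_EFinP; exact: measurable_int fi.
set b := (rV_uncons t).1; set s := (rV_uncons t).2.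
pose F (p : measurableTypeR R * 'rV[R]_d) := f (rV_cons p).
have mF : measurable_fun [set: measurableTypeR R * 'rV[R]_d] F.
  by apply: (measurableT_comp mf); exact: measurable_rV_cons.
have iF : (@lebesgue_measure R \x lebesgue_rV d).-integrable [set: _] (EFin \o F).
  apply/integrable12ltyP; first exact/measurable_EFinP.
  have /integrableP[_] := fi.
  rewrite (@ge0_integral_rV_cons _ _ (fun x => `|(f x)%:E|))//.
  by apply: measurableT_comp => //; exact/measurable_EFinP.
have mN d' (T : measurableType d') (h : T -> R) : measurable_fun [set: T] h ->
    measurable_fun [set: T] (fun x => `|(h x)%:E|).
  by move=> mh; apply: measurableT_comp => //; exact/measurable_EFinP.
pose r n : R := (n.+1%:R^-1)%R.
have msh1 n : measurable_fun [set: measurableTypeR R * 'rV[R]_d]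
    (fun p : measurableTypeR R * 'rV[R]_d => ((p.1 + r n * b)%R : measurableTypeR R,
        p.2)).
  apply: measurable_fun_pair; last exact: measurable_snd.
  by apply: measurable_funD => //; exact: measurable_fst.
have msh2 n : measurable_fun [set: measurableTypeR R * 'rV[R]_d]
    (fun p : measurableTypeR R * 'rV[R]_d => (p.1, p.2 + r n *: s)%R).
  apply: measurable_fun_pair; first exact: measurable_fst.
  apply: (measurableT_comp (measurable_rV_shift _)); exact: measurable_snd.
pose A n (y : 'rV[R]_d) := \int[leb]_a `|(F ((a + r n * b)%R, y) - F (a, y))%:E|.
pose B n (a : measurableTypeR R) := \int[mu d]_y `|(F (a, y + r n *: s)%R - F (a, y))%:E|.
have mA n : measurable_fun [set: _] (A n).
  apply: (measurable_fun_fubini_tonelli_G (fun p : measurableTypeR R * 'rV[R]_d =>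
    `|(F ((p.1 + r n * b)%R, p.2) - F p)%:E|)) => //=.
  by apply: mN; apply: measurable_funB => //; exact: (measurableT_comp mF (msh1 n)).
have mB n : measurable_fun [set: _] (B n).
  apply: (measurable_fun_fubini_tonelli_F (fun p : measurableTypeR R * 'rV[R]_d =>
    `|(F (p.1, p.2 + r n *: s)%R - F p)%:E|)) => //=.
  by apply: mN; apply: measurable_funB => //; exact: (measurableT_comp mF (msh2 n)).
apply: (@cvge0_le _ _ (fun n => \int[mu d]_y A n y + \int[leb]_a B n a)).
  move=> n; rewrite integral_ge0//=.
  rewrite (@ge0_integral_rV_cons _ _ (fun x => `|(f (x + n.+1%:R^-1 *: t)%R - f
      x)%:E|))//; last first.
    apply: mN; apply: measurable_funB => //; exact: (measurableT_comp mf
        (measurable_rV_shift _)).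
  have Et a y : f (rV_cons (a, y) + n.+1%:R^-1 *: t)%R = F ((a + r n * b)%R, (y + r n
      *: s)%R).
    by rewrite -{1}(@rV_unconsK _ _ t) [rV_uncons t]surjective_pairing rV_consZ rV_consD.
  have mF1 (a : measurableTypeR R) : measurable_fun [set: _] (fun y : 'rV[R]_d => F (a,
      y)).
    exact: (measurableT_comp mF (@measurable_pair1 _ _ _ _ a)).
  have mA2 : measurable_fun [set: _] (fun a : measurableTypeR R =>
      \int[mu d]_y `|(F ((a + r n * b)%R, y) - F (a, y))%:E|).
    apply: (measurable_fun_fubini_tonelli_F (fun p : measurableTypeR R * 'rV[R]_d =>
      `|(F ((p.1 + r n * b)%R, p.2) - F p)%:E|)) => //=.
    by apply: mN; apply: measurable_funB => //; exact: (measurableT_comp mF (msh1 n)).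
  have -> : \int[mu d]_y A n y = \int[leb]_a \int[mu d]_y
      `|(F ((a + r n * b)%R, y) - F (a, y))%:E|.
    rewrite -(@fubini_tonelli _ _ _ _ _ _ (lebesgue_rV d) (fun p : measurableTypeR R *
        'rV[R]_d =>
      `|(F ((p.1 + r n * b)%R, p.2) - F p)%:E|))//=.
    by apply: mN; apply: measurable_funB => //; exact: (measurableT_comp mF (msh1 n)).
  rewrite -ge0_integralD//; last 2 first.
  - by move=> a _; exact: integral_ge0.
  - by move=> a _; exact: integral_ge0.
  apply: ge0_le_integral => //.
  - by move=> a _; exact: integral_ge0.
  - apply: (measurable_fun_fubini_tonelli_F (fun p : measurableTypeR R * 'rV[R]_d =>
      `|(f (rV_cons p + n.+1%:R^-1 *: t)%R - f (rV_cons p))%:E|)) => //=.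
    apply: mN; apply: measurable_funB => //.
    apply: (measurableT_comp mf); apply: (measurableT_comp (measurable_rV_shift _)).
    exact: measurable_rV_cons.
  - exact: emeasurable_funD.
  move=> a _; rewrite /B.
  (* Shift invariance in [y] moves the first difference to the slice at y + r s, where it meets the
     second one in the triangle inequality. *)
  have -> : \int[mu d]_y `|(F ((a + r n * b)%R, y) - F (a, y))%:E| =
     \int[mu d]_y `|(F ((a + r n * b)%R, y + r n *: s)%R - F (a, y + r n *: s)%R)%:E|.
    rewrite (@ge0_integral_rV_shift _ _ (r n *: s) (fun y => `|(F ((a + r n * b)%R, y)
        - F (a, y))%:E|))//.
    by apply: mN; exact: measurable_funB.
  have mF2 (a' : measurableTypeR R) : measurable_fun [set: _] (fun y : 'rV[R]_d => F
      (a', y + r n *: s)%R).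
    exact: (measurableT_comp (mF1 a') (measurable_rV_shift _)).
  rewrite -ge0_integralD//; last 2 first.
  - by apply: mN; exact: measurable_funB.
  - by apply: mN; exact: measurable_funB.
  apply: ge0_le_integral => //.
  - rewrite [X in measurable_fun _ X](_ : _ = fun y : 'rV[R]_d =>
        `|(F ((a + r n * b)%R, (y + r n *: s)%R) - F (a, y))%:E|).
      by apply: mN; apply: measurable_funB; [exact: mF2|exact: mF1].
    by apply/funext => y; rewrite Et.
  - by apply: emeasurable_funD; apply: mN; exact: measurable_funB.
  - move=> y _; rewrite Et -EFinD lee_fin.
    exact: ler_distD.
apply: cvge0D.
- apply: (@dominated_cvge0 R _ _ (mu d) A (fun y => 2%:E * \int[leb]_a `|(F (a, y))%:E|)).
  + exact: mA.
  + apply: integrableZl => //.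
    have mNF := mN _ _ F mF; apply/integrableP; split.
      by apply: (measurable_fun_fubini_tonelli_G (fun p => `|(F p)%:E|)).
    under eq_integral do rewrite gee0_abs ?integral_ge0//.
    by have /integrable21ltyP := iF; apply; exact/measurable_EFinP.
  + move=> n y; rewrite integral_ge0//=.
    apply: (@integral_normB_shift1_le (fun a => F (a, y))).
    exact: (measurableT_comp mF (@measurable_pair2 _ _ _ _ y)).
  + have := ae_integrable2 iF; apply: filterS => y iy.
    exact: (@cvg_L1_shift1 _ (fun a => F (a, y))).
- apply: (@dominated_cvge0 R _ _ (@lebesgue_measure R) B (fun a => 2%:E * \int[mu d]_y
    `|(F (a, y))%:E|)).
  + exact: mB.
  + apply: integrableZl => //.
    have mNF := mN _ _ F mF; apply/integrableP; split.
      by apply: (measurable_fun_fubini_tonelli_F (fun p => `|(F p)%:E|)).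
    under eq_integral do rewrite gee0_abs ?integral_ge0//.
    by have /integrable12ltyP := iF; apply; exact/measurable_EFinP.
  + move=> n a; rewrite integral_ge0//=.
    apply: (@integral_normB_rV_shift_le _ (fun y : 'rV[R]_d => F (a, y))).
    exact: (measurableT_comp mF (@measurable_pair1 _ _ _ _ a)).
  + have := ae_integrable1 iF; apply: filterS => a ia.
    exact: ih.
Qed.

End translation.

(** * Plancherel's theorem for bounded integrable functions *)

Section expi.
Context {R : realType}.
Local Notation N := (@Normc.normc R).

Lemma normc_expi (t : R) : N (expi t) = 1.
Proof. by rewrite /expi /= cos2Dsin2 sqrtr1. Qed.

Lemma expiD (a b : R) : expi (a + b) = expi a * expi b.
Proof. by rewrite /expi cosD sinD; simpc; congr Complex; ring. Qed.

Lemma conjcM (z w : R[i]) : conjc (z * w) = conjc z * conjc w.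
Proof. exact: rmorphM. Qed.

Lemma expiN (a : R) : expi (- a) = conjc (expi a).
Proof. by rewrite /expi cosN sinN. Qed.

Lemma cmfun_expi d (T : measurableType d) (h : T -> R) : measurable_fun [set: T] h ->
  cmfun (fun x => expi (h x)).
Proof.
move=> mh; split.
- exact: (measurableT_comp (continuous_measurable_fun (@continuous_cos R))).
- exact: (measurableT_comp (continuous_measurable_fun (@continuous_sin R))).
Qed.

End expi.

Section L2_theory.
Context {R : realType} {d : nat}.
Local Notation mu := (@lebesgue_rV R d : {measure set 'rV[R]_d -> \bar R}).
Local Notation N := (@Normc.normc R).
Implicit Types f g k : 'rV[R]_d -> R[i].

Lemma sqnormL2_ge0 f : (0 <= sqnormL2 f)%E.
Proof. by apply: integral_ge0 => x _; rewrite lee_fin sqr_ge0. Qed.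

Lemma eq_sqnormL2 f g : (forall x, N (f x) = N (g x)) -> sqnormL2 f = sqnormL2 g.
Proof. by move=> fg; apply: eq_integral => x _; rewrite fg. Qed.

Lemma sqnormL2N f : sqnormL2 (fun x => - f x) = sqnormL2 f.
Proof. by apply: eq_sqnormL2 => x; rewrite normcN. Qed.

Lemma L2D f g : L2 f -> L2 g -> L2 (fun x => f x + g x).
Proof.
move=> [mf f2] [mg g2]; split; first exact: cmfunD.
apply: (@le_lt_trans _ _ (\int[mu]_x (2%:E * (N (f x) ^+ 2)%:E + 2%:E * (N (g x) ^+
    2)%:E))%E).
  apply: ge0_le_integral => //.
  - by move=> x _; rewrite lee_fin sqr_ge0.
  - by apply/measurable_EFinP/measurable_normc_sqr; exact: cmfunD.
  - by apply: emeasurable_funD; apply/measurable_EFinP;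
      apply: measurable_funM => //; exact: measurable_normc_sqr.
  - move=> x _; rewrite -!EFinM -EFinD lee_fin.
    have := le_normcD (f x) (g x).
    have := normc_ge0 (f x); have := normc_ge0 (g x); have := normc_ge0 (f x + g x).
    move: (N (f x + g x)) (N (f x)) (N (g x)) => a b c a0 b0 c0 abc.
    have : a ^+ 2 <= (b + c) ^+ 2 by rewrite ler_sqr ?nnegrE ?addr_ge0.
    move=> /le_trans; apply; have := sqr_ge0 (b - c); nra.
rewrite ge0_integralD//; last 4 first.
- by move=> x _; rewrite -EFinM lee_fin mulr_ge0 ?sqr_ge0.
- by apply/measurable_EFinP; apply: measurable_funM => //; exact: measurable_normc_sqr.
- by move=> x _; rewrite -EFinM lee_fin mulr_ge0 ?sqr_ge0.
- by apply/measurable_EFinP; apply: measurable_funM => //; exact: measurable_normc_sqr.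
have m2 h : cmeasurable h -> measurable_fun [set: 'rV[R]_d] (fun x => (N (h x) ^+ 2)%:E).
  by move=> mh; apply/measurable_EFinP/measurable_normc_sqr.
rewrite !ge0_integralZl//; try exact: m2; last 2 first.
- by move=> x _; rewrite lee_fin sqr_ge0.
- by move=> x _; rewrite lee_fin sqr_ge0.
by rewrite lte_add_pinfty// lte_mul_pinfty// ge0_fin_numE.
Qed.

Lemma L2N f : L2 f -> L2 (fun x => - f x).
Proof. by move=> [mf f2]; split; [exact: cmfunN|rewrite sqnormL2N]. Qed.

Lemma L2B f g : L2 f -> L2 g -> L2 (fun x => f x - g x).
Proof. by move=> f2 g2; apply: L2D => //; exact: L2N. Qed.

Lemma L2_bounded f (M : R) : L1 f -> (forall x, N (f x) <= M) -> L2 f.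
Proof.
move=> [mf f1] fM; split => //.
apply: (@le_lt_trans _ _ (\int[mu]_x (M%:E * (N (f x))%:E))%E).
  apply: ge0_le_integral => //.
  - by move=> x _; rewrite lee_fin sqr_ge0.
  - by apply/measurable_EFinP/measurable_normc_sqr.
  - by apply/measurable_EFinP; apply: measurable_funM => //; exact: measurable_normc.
  - by move=> x _; rewrite -EFinM lee_fin expr2 ler_wpM2r ?normc_ge0.
have M0 : 0 <= M by rewrite (le_trans (normc_ge0 (f 0))).
rewrite ge0_integralZl//.
- by rewrite lte_mul_pinfty.
- by apply/measurable_EFinP/measurable_normc.
- by move=> x _; rewrite lee_fin normc_ge0.
Qed.

(* Cauchy-Schwarz in the form [2 |f| |k| <= t |f|^2 + t^-1 |k|^2]. *)
Lemma innerL2_bound f k (t : R) : 0 < t -> L2 f -> L2 k ->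
  L1 (fun x => f x * conjc (k x)) /\
  ((N (innerL2 f k))%:E <= t%:E * sqnormL2 f + t^-1%:E * sqnormL2 k)%E.
Proof.
move=> t0 [mf f2] [mk k2].
have mfk : cmfun (fun x => f x * conjc (k x)) by apply: cmfunM => //; exact: cmfunJ.
have m2 h : cmeasurable h -> measurable_fun [set: 'rV[R]_d] (fun x => (N (h x) ^+ 2)%:E).
  by move=> mh; apply/measurable_EFinP/measurable_normc_sqr.
have t0' : 0 <= t by exact: ltW.
have H : (2%:E * \int[mu]_x (N (f x * conjc (k x)))%:E <=
     t%:E * sqnormL2 f + t^-1%:E * sqnormL2 k)%E.
  rewrite /sqnormL2 -ge0_integralZl//; last 2 first.
  - by apply/measurable_EFinP/measurable_normc.
  - by move=> x _; rewrite lee_fin normc_ge0.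
  rewrite -ge0_integralZl//; try exact: m2; last first.
    by move=> x _; rewrite lee_fin sqr_ge0.
  rewrite -ge0_integralZl//; try exact: m2; last 2 first.
  - by move=> x _; rewrite lee_fin sqr_ge0.
  - by rewrite lee_fin invr_ge0.
  rewrite -ge0_integralD//; last 4 first.
  - by move=> x _; rewrite -EFinM lee_fin mulr_ge0 ?sqr_ge0.
  - by apply/measurable_EFinP; apply: measurable_funM => //; exact: measurable_normc_sqr.
  - by move=> x _; rewrite -EFinM lee_fin mulr_ge0 ?sqr_ge0 ?invr_ge0.
  - by apply/measurable_EFinP; apply: measurable_funM => //; exact: measurable_normc_sqr.
  apply: ge0_le_integral => //.
  - by move=> x _; rewrite -EFinM lee_fin mulr_ge0 ?normc_ge0.
  - by apply/measurable_EFinP; apply: measurable_funM => //; exact: measurable_normc.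
  - by apply: emeasurable_funD; apply/measurable_EFinP;
      apply: measurable_funM => //; exact: measurable_normc_sqr.
  - move=> x _; rewrite -!EFinM -EFinD lee_fin Normc.normcM normcJ.
    move: (N (f x)) (N (k x)) => a b.
    rewrite -subr_ge0 [X in 0 <= X](_ : _ = t^-1 * (t * a - b) ^+ 2).
      by rewrite mulr_ge0 ?sqr_ge0 ?invr_ge0.
    by field; rewrite gt_eqF.
have L : L1 (fun x => f x * conjc (k x)).
  split => //.
  rewrite -(@lte_pmul2l _ 2%:E)//= ?lte_fin// mulry gtr0_sg// mul1e.
  apply: (le_lt_trans H).
  by rewrite lte_add_pinfty// lte_mul_pinfty ?lee_fin ?invr_ge0.
split => //; exact: (le_trans (normc_cint L) H).
Qed.

Lemma innerL2B f g k : L2 f -> L2 g -> L2 k ->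
  innerL2 f (fun x => g x - k x) = innerL2 f g - innerL2 f k.
Proof.
move=> f2 g2 k2.
have [fg _] := innerL2_bound ltr01 f2 g2; have [fk _] := innerL2_bound ltr01 f2 k2.
rewrite -(cintB fg fk); apply: eq_cint => x.
by rewrite rmorphB/= mulrBr.
Qed.

Lemma innerL2_diag f : innerL2 f f = (fine (sqnormL2 f))%:C.
Proof.
rewrite -[RHS](cint_real mu (fun x => N (f x) ^+ 2)).
by apply: eq_cint => x; rewrite mulcJ.
Qed.

End L2_theory.

(** * The multiplication formula *)

Section fourier.
Context {R : realType} {d : nat}.
Local Notation mu := (@lebesgue_rV R d : {measure set 'rV[R]_d -> \bar R}).
Local Notation N := (@Normc.normc R).
Implicit Types f g u : 'rV[R]_d -> R[i].

Definition ifourierL1 g (x : 'rV[R]_d) : R[i] :=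
  cintegral (fun w => g w * expi (2 * pi * dotp w x)).

Lemma dotpC (x y : 'rV[R]_d) : dotp x y = dotp y x.
Proof. by apply: eq_bigr => i _; rewrite mulrC. Qed.

Lemma dotpDl (x y z : 'rV[R]_d) : dotp (x + y) z = dotp x z + dotp y z.
Proof. by rewrite -big_split; apply: eq_bigr => i _; rewrite mxE mulrDl. Qed.

Lemma dotpNl (x z : 'rV[R]_d) : dotp (- x) z = - dotp x z.
Proof. by rewrite -sumrN; apply: eq_bigr => i _; rewrite mxE mulNr. Qed.

Lemma dotpZl (c : R) (x z : 'rV[R]_d) : dotp (c *: x) z = c * dotp x z.
Proof. by rewrite mulr_sumr; apply: eq_bigr => i _; rewrite mxE mulrA. Qed.

Lemma measurable_dotp2 :
  measurable_fun [set: 'rV[R]_d * 'rV[R]_d] (fun p => dotp p.1 p.2).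
Proof.
apply: measurable_sum => i; apply: measurable_funM.
  apply: (measurableT_comp (@measurable_rV_coord _ R d i)); exact: measurable_fst.
apply: (measurableT_comp (@measurable_rV_coord _ R d i)); exact: measurable_snd.
Qed.

Lemma cmfun_expi_dotp (c : R) :
  cmfun (fun p : 'rV[R]_d * 'rV[R]_d => expi (c * dotp p.1 p.2)).
Proof. by apply: cmfun_expi; apply: measurable_funM => //; exact: measurable_dotp2. Qed.

Lemma cmfun_expi_dotpl (c : R) (x : 'rV[R]_d) :
  cmfun (fun w : 'rV[R]_d => expi (c * dotp w x)).
Proof.
apply: (@cmfun_comp _ _ _ _ _ (fun p : 'rV[R]_d * 'rV[R]_d => expi (c * dotp p.1 p.2))
    (fun w => (w, x))).
  exact: cmfun_expi_dotp.
exact: measurable_pair2.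
Qed.

Lemma L1_expi g (h : 'rV[R]_d -> R) : measurable_fun [set: _] h -> L1 g ->
  L1 (fun x => g x * expi (h x)).
Proof.
move=> mh g1; have := @cL1Ml _ _ _ mu _ (fun x => expi (h x)) 1 (cmfun_expi mh) _ g1.
move=> /(_ (fun x => _)) H.
under eq_fun do rewrite mulrC.
by apply: H => x; rewrite normc_expi.
Qed.

Lemma L1_expi_dotpl g (c : R) x : L1 g -> L1 (fun w => g w * expi (c * dotp w x)).
Proof.
move=> g1; apply: L1_expi => //; apply: measurable_funM => //.
by under eq_fun do rewrite dotpC; exact: measurable_dotp.
Qed.

Lemma cmeasurable_ifourierL1 g : cmeasurable g -> cmeasurable (ifourierL1 g).
Proof.
move=> mg.
apply: (@cmfun_cint _ _ _ _ _ (lebesgue_rV d) (fun p : 'rV[R]_d * 'rV[R]_d =>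
  g p.2 * expi (2 * pi * dotp p.2 p.1))).
apply: cmfunM.
  by apply: (cmfun_comp mg); exact: measurable_snd.
by under eq_fun do rewrite dotpC; exact: cmfun_expi_dotp.
Qed.

Lemma cmeasurable_fourierL1 g : cmeasurable g -> cmeasurable (fourierL1 g).
Proof.
move=> mg.
apply: (@cmfun_cint _ _ _ _ _ (lebesgue_rV d) (fun p : 'rV[R]_d * 'rV[R]_d =>
  g p.2 * expi (- (2 * pi * dotp p.1 p.2)))).
apply: cmfunM.
  by apply: (cmfun_comp mg); exact: measurable_snd.
by under eq_fun do rewrite -mulNr; exact: cmfun_expi_dotp.
Qed.

Lemma normc_ifourierL1 g x : L1 g ->
  ((N (ifourierL1 g x))%:E <= 2%:E * \int[mu]_w (N (g w))%:E)%E.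
Proof.
move=> g1; apply: (le_trans (normc_cint (L1_expi_dotpl _ _ g1))).
rewrite lee_pmul2l// le_eqVlt; apply/orP; left; apply/eqP.
by apply: eq_integral => w _; rewrite Normc.normcM normc_expi mulr1.
Qed.

(** Both sides are the double integral of g(w) conj(u(x)) against the character, in the two orders.
    It is used three times: with [u] a damped character, with [u] a damped inverse transform, and
    with [u] an approximant of [h]. *)
Lemma innerL2_ifourierL1 g u : L1 g -> L1 u ->
  innerL2 (ifourierL1 g) u = innerL2 g (fourierL1 u).
Proof.
move=> g1 u1.
pose K (p : 'rV[R]_d * 'rV[R]_d) := g p.1 * expi (2 * pi * dotp p.1 p.2) * conjc (u p.2).
have mK : cmfun K.
  apply: cmfunM; first apply: cmfunM.
  - by case: g1 => mg _; apply: (cmfun_comp mg); exact: measurable_fst.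
  - exact: cmfun_expi_dotp.
  - by case: u1 => mu1 _; apply: cmfunJ; apply: (cmfun_comp mu1); exact: measurable_snd.
have K1 w : (fun x => K (w, x)) =
    (fun x => g w * conjc (u x * expi (- (2 * pi * dotp w x)))).
  apply/funext => x; rewrite /K conjcM -expiN opprK -mulrA; congr (_ * _).
  exact: mulrC.
have K2 x : (fun w => K (w, x)) =
    (fun w => conjc (u x) * (g w * expi (2 * pi * dotp w x))).
  by apply/funext => w; rewrite /K/= mulrC.
have u1e w : L1 (fun x => u x * expi (- (2 * pi * dotp w x))).
  apply: L1_expi => //; apply: measurable_funN; apply: measurable_funM => //.
  exact: measurable_dotp.
transitivity (cintegral (fun x => cintegral (fun w => K (w, x)))).
  apply: eq_cint => x; rewrite K2 [RHS]cintZ 1?mulrC//.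
  exact: L1_expi_dotpl.
transitivity (cintegral (fun w => cintegral (fun x => K (w, x)))); last first.
  apply: eq_cint => w; rewrite K1 [LHS]cintZ; last by apply: cL1J; exact: u1e.
  rewrite [X in _ * X = _]cintJ; last exact: u1e.
  by [].
symmetry; apply: (@cint_fubini _ _ _ _ _ (lebesgue_rV d) (lebesgue_rV d) K) => //.
- under eq_integral => w _.
    under eq_integral do rewrite /K /= !Normc.normcM normc_expi mulr1 normcJ EFinM.
    rewrite ge0_integralZl//; last 3 first.
    + by apply/measurable_EFinP/measurable_normc; case: u1.
    + by move=> x _; rewrite lee_fin normc_ge0.
    + by rewrite lee_fin normc_ge0.
    over.
  case: g1 => mg gy; case: u1 => mu1 uy.
  rewrite /= ge0_integralZr//; last 3 first.
  + by apply/measurable_EFinP/measurable_normc.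
  + by move=> x _; rewrite lee_fin normc_ge0.
  + by apply: integral_ge0 => x _; rewrite lee_fin normc_ge0.
  apply: lte_mul_pinfty => //.
  + by apply: integral_ge0 => x _; rewrite lee_fin normc_ge0.
  + rewrite ge0_fin_numE//; apply: integral_ge0 => x _; rewrite lee_fin normc_ge0//.
- by move=> w; rewrite K1; apply: cL1Z; apply: cL1J; exact: u1e.
- by move=> x; rewrite K2; apply: cL1Z; exact: L1_expi_dotpl.
Qed.

End fourier.

(** * Inversion and Plancherel's theorem by damping *)

Section inversion.
Context {R : realType} {d : nat}.
Local Notation mu := (@lebesgue_rV R d : {measure set 'rV[R]_d -> \bar R}).
Local Notation N := (@Normc.normc R).
Implicit Types f g u : 'rV[R]_d -> R[i].

(* [pkn n] is the Fourier transform of [gamn n]. *)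
Definition pkn (n : nat) (s : 'rV[R]_d) : R := n.+1%:R ^+ d * pk (n.+1%:R *: s).

Definition gamn (n : nat) (x : 'rV[R]_d) : R := gam (n.+1%:R^-1 *: x).

Lemma pkn_ge0 n s : 0 <= pkn n s.
Proof. by rewrite mulr_ge0 ?exprn_ge0// pk_ge0. Qed.

Lemma pknN n s : pkn n (- s) = pkn n s.
Proof. by rewrite /pkn scalerN pkN. Qed.

Lemma measurable_pkn n : measurable_fun [set: 'rV[R]_d] (pkn n).
Proof.
apply: measurable_funM => //.
exact: (measurableT_comp (@measurable_pk R d) (measurable_rV_scale _)).
Qed.

Lemma measurable_gamn n : measurable_fun [set: 'rV[R]_d] (gamn n).
Proof. exact: (measurableT_comp (@measurable_gam R d) (measurable_rV_scale _)). Qed.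

(** The substitution moves the width of the kernel into the argument of [h]; the weight [pk] no
    longer depends on [n], as dominated convergence requires. *)
Lemma ge0_integral_pkn n (h : 'rV[R]_d -> \bar R) : (forall x, 0 <= h x)%E ->
  measurable_fun [set: _] h ->
  (\int[mu]_s (h s * (pkn n s)%:E) = \int[mu]_s (h (n.+1%:R^-1 *: s) * (pk s)%:E))%E.
Proof.
move=> h0 mh.
have mF : measurable_fun [set: 'rV[R]_d] (fun s => h (n.+1%:R^-1 *: s) * (pk s)%:E)%E.
  apply: emeasurable_funM; last by apply/measurable_EFinP; exact: measurable_pk.
  exact: (measurableT_comp mh (measurable_rV_scale _)).
rewrite -[RHS](@ge0_integral_rV_scale _ _ n.+1%:R)//; last first.
  by move=> x; rewrite mule_ge0// lee_fin pk_ge0.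
rewrite -ge0_integralZl//; last 2 first.
- exact: (measurableT_comp mF (measurable_rV_scale n.+1%:R)).
- by move=> x _; rewrite mule_ge0// lee_fin pk_ge0.
apply: eq_integral => s _; rewrite scalerA mulVf// scale1r.
by rewrite muleCA -EFinM.
Qed.

Lemma ge0_integral_pkn1 n : (\int[mu]_s (pkn n s)%:E = 1)%E.
Proof.
have [pi1 pe1] := @integral_pk R d.
transitivity (\int[mu]_s (1 * (pkn n s)%:E))%E.
  by apply: eq_integral => s _; rewrite mul1e.
rewrite (@ge0_integral_pkn _ (fun=> 1%E))//.
rewrite -[in RHS]pe1 /Rintegral fineK//; last exact: integrable_fin_num.
by apply: eq_integral => s _; rewrite mul1e.
Qed.

Lemma integrable_pkn n : mu.-integrable [set: _] (EFin \o pkn n).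
Proof.
apply/integrableP; split; first by apply/measurable_EFinP; exact: measurable_pkn.
under eq_integral => s _ do rewrite /= ger0_norm ?pkn_ge0//.
by rewrite ge0_integral_pkn1 ltry.
Qed.

Lemma gamn_gt0 n x : 0 < gamn n x. Proof. exact: gam_gt0. Qed.

Lemma gamn_le1 n x : gamn n x <= 1. Proof. exact: gam_le1. Qed.

Lemma L1_gam (c : R) : 0 < c -> L1 (fun x : 'rV[R]_d => (gam (c *: x))%:C).
Proof.
move=> c0.
have mg : measurable_fun [set: 'rV[R]_d] (fun x => gam (c *: x)).
  exact: (measurableT_comp (@measurable_gam R d) (measurable_rV_scale _)).
split; first exact: cmfun_real.
have /integrableP[_] := @integrable_gam R d.
rewrite -(@ge0_integral_rV_scale _ _ c (fun x => `|(EFin \o gam (d := d)) x|%E) c0)//;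
    last first.
  by apply: measurableT_comp => //; apply/measurable_EFinP; exact: measurable_gam.
rewrite (@eq_integral _ _ _ mu _ (fun x : 'rV[R]_d => (N (gam (c *: x))%:C)%:E)); last
    first.
  by move=> x _; rewrite normcR.
move=> H; rewrite -(@lte_pmul2l _ (c ^+ d)%:E)// ?lte_fin ?exprn_gt0//.
by rewrite mulry gtr0_sg ?exprn_gt0// mul1e.
Qed.

Lemma L1_gamn n : L1 (fun x => (gamn n x)%:C).
Proof. by apply: L1_gam; rewrite invr_gt0. Qed.

Lemma cintegral_gamn n (v : 'rV[R]_d) :
  cintegral (fun x => (gamn n x)%:C * expi (2 * pi * dotp v x)) = (pkn n v)%:C.
Proof.
have [_ ic is_ ec es] := integral_gam_cos_sin (n.+1%:R *: v).
have n0 : 0 < n.+1%:R^-1 :> R by rewrite invr_gt0.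
have n1 : n.+1%:R ^+ d != 0 :> R by rewrite expf_neq0.
have H (h : R -> R) : mu.-integrable [set: _]
    (EFin \o (fun x => gam x * h (2 * pi * dotp (n.+1%:R *: v) x))) ->
  (\int[mu]_x (gamn n x * h (2 * pi * dotp v x)))%R =
  n.+1%:R ^+ d * (\int[mu]_x (gam x * h (2 * pi * dotp (n.+1%:R *: v) x)))%R.
  move=> ih; rewrite -(Rintegral_rV_scale n0 ih) exprVn mulrA divff// mul1r.
  apply: eq_Rintegral => x _; congr (_ * h (_ * _)).
  rewrite dotpZl [in RHS]dotpC dotpZl mulrA divff// mul1r.
  by rewrite dotpC.
rewrite /cintegral; congr Complex.
- rewrite [LHS](@eq_Rintegral _ _ _ _ _ (fun x => gamn n x * cos (2 * pi * dotp v x))).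
    by rewrite (H cos)// ec.
  by move=> x _; rewrite /expi/= mul0r subr0.
- rewrite [LHS](@eq_Rintegral _ _ _ _ _ (fun x => gamn n x * sin (2 * pi * dotp v x))).
    by rewrite (H sin)// es mulr0.
  by move=> x _; rewrite /expi/= mul0r addr0.
Qed.

Variables (g : 'rV[R]_d -> R[i]) (M : R).
Hypotheses (g1 : L1 g) (gM : forall x, N (g x) <= M).

Let mg : cmeasurable g. Proof. by case: g1. Qed.

Let M0 : 0 <= M. Proof. by rewrite (le_trans (normc_ge0 (g 0))). Qed.

(** The inverse transform of [g] is a priori only bounded; damping makes it integrable. This is the
    approximating sequence that [is_fourierL2] asks for. *)
Definition cutoff n (x : 'rV[R]_d) : R[i] := (gamn n x)%:C * ifourierL1 g x.

Let mf : cmeasurable (ifourierL1 g). Proof. exact: cmeasurable_ifourierL1. Qed.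

(** Twice the L^1 norm of [g]: it bounds the inverse transform uniformly and also, by shift
    invariance, the L^1 distance from [g] to each of its translates. *)
Let A := fine (2%:E * \int[mu]_w (N (g w))%:E)%E.

Let fA x : N (ifourierL1 g x) <= A.
Proof.
rewrite -lee_fin /A fineK; first exact: normc_ifourierL1.
rewrite ge0_fin_numE.
  by apply: lte_mul_pinfty => //; case: g1.
by apply: mule_ge0 => //; apply: integral_ge0 => x' _; rewrite lee_fin normc_ge0.
Qed.

Let L1_cutoff n : L1 (cutoff n).
Proof.
rewrite /cutoff; under eq_fun do rewrite mulrC.
exact: (cL1Ml mf fA (L1_gamn n)).
Qed.

Let cutoff_le n x : N (cutoff n x) <= N (ifourierL1 g x).
Proof.
rewrite Normc.normcM ler_piMl ?normc_ge0// normcR ger0_norm ?gamn_le1//.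
exact/ltW/gamn_gt0.
Qed.

Let L2_cutoff n : L2 (cutoff n).
Proof.
by apply: (L2_bounded (M := A)) => // x; rewrite (le_trans (cutoff_le _ _)).
Qed.

(** The multiplication formula with the damped character [k] at frequency [v], whose transform is
    the kernel centred at [v]; a shift by [v] and the evenness of the kernel give the
    convolution. *)
Lemma fourierL1_cutoff n v :
  fourierL1 (cutoff n) v = cintegral (fun s => g (s + v) * (pkn n s)%:C).
Proof.
pose k x : R[i] := (gamn n x)%:C * expi (2 * pi * dotp v x).
have mdot : measurable_fun [set: 'rV[R]_d] (fun x => 2 * pi * dotp v x).
  by apply: measurable_funM => //; exact: measurable_dotp.
have k1 : L1 k by exact: (L1_expi mdot (L1_gamn n)).
have ku w : fourierL1 k w = (pkn n (v - w))%:C.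
  rewrite -cintegral_gamn; apply: eq_cint => x; rewrite /k -mulrA -expiD.
  by congr (_ * expi _); rewrite dotpDl dotpNl; ring.
transitivity (innerL2 (ifourierL1 g) k).
  apply: eq_cint => x; rewrite /cutoff /k conjcM conjc_real -expiN.
  by rewrite mulrAC mulrC.
rewrite innerL2_ifourierL1//.
transitivity (cintegral (fun w => g w * (pkn n (v - w))%:C)).
  by apply: eq_cint => w; rewrite ku conjc_real.
rewrite -(@cintegral_shift _ _ v).
  by apply: eq_cint => s; rewrite opprD addrCA subrr addr0 pknN.
apply: cmfunM => //; apply: cmfun_real.
under eq_fun do rewrite -pknN opprB.
exact: (measurableT_comp (measurable_pkn n) (measurable_rV_shift _)).
Qed.

Let pknL1 n (h : 'rV[R]_d -> R[i]) (B : R) : cmeasurable h -> (forall x, N (h x) <= B) ->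
  L1 (fun s => h s * (pkn n s)%:C).
Proof.
move=> mh hB; apply: (cL1Ml mh hB).
apply: (cL1_le _ _ (integrable_pkn n)); first exact: cmfun_real (measurable_pkn n).
by move=> x; rewrite normcR ger0_norm ?pkn_ge0.
Qed.

Let mgs v : cmeasurable (fun s => g (s + v)).
Proof. by apply: (cmfun_comp mg); exact: measurable_rV_shift. Qed.

Lemma fourierL1_cutoffB n v : fourierL1 (cutoff n) v - g v =
  cintegral (fun s => (g (s + v) - g v) * (pkn n s)%:C).
Proof.
rewrite fourierL1_cutoff.
have E : g v = cintegral (fun s => g v * (pkn n s)%:C).
  rewrite [RHS]cintZ.
    rewrite [cint _ _](_ : _ = 1) ?mulr1// cint_real /Rintegral.
    by rewrite ge0_integral_pkn1.
  have := @pknL1 n (fun=> 1) 1 (cmfun_cst _ _).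
  rewrite Normc.normc1 => /(_ (fun=> lexx _)).
  by under eq_fun do rewrite mul1r.
rewrite [X in _ - X = _]E -[RHS]/(cint _ _) -[LHS]/(cint _ _ - cint _ _) -cintB; last 2
    first.
- exact: (pknL1 _ (mgs v)).
- by apply: (@pknL1 n (fun=> g v)) => //; exact: cmfun_cst.
by apply: eq_cint => s; rewrite mulrBl.
Qed.

Let del n v : R := N (fourierL1 (cutoff n) v - g v).

Let dif v s : R := N (g (s + v) - g v).

Let dif_le v s : dif v s <= 2 * M.
Proof.
by rewrite /dif (le_trans (le_normcD _ _))// normcN mulr_natl mulr2n lerD.
Qed.

Let mdif : measurable_fun [set: 'rV[R]_d * 'rV[R]_d] (fun p => dif p.1 p.2).
Proof.
apply: measurable_normc; apply: cmfunB.
  apply: (cmfun_comp mg); apply: measurable_fun_rV => i.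
  under eq_fun do rewrite mxE.
  apply: measurable_funD.
    apply: (measurableT_comp (@measurable_rV_coord _ R d i)); exact: measurable_snd.
  apply: (measurableT_comp (@measurable_rV_coord _ R d i)); exact: measurable_fst.
by apply: (cmfun_comp mg); exact: measurable_fst.
Qed.

Let mdifl v : measurable_fun [set: 'rV[R]_d] (dif v).
Proof. exact: (measurableT_comp mdif (@measurable_pair1 _ _ _ _ v)). Qed.

Let mdifr s : measurable_fun [set: 'rV[R]_d] (dif ^~ s).
Proof. exact: (measurableT_comp mdif (@measurable_pair2 _ _ _ _ s)). Qed.

Let del_le n v : ((del n v)%:E <= 2%:E * \int[mu]_s (dif v s * pkn n s)%:E)%E.
Proof.
rewrite /del fourierL1_cutoffB.
apply: (le_trans (normc_cint _)).
  apply: (@pknL1 n _ (2 * M)); last by move=> s; exact: dif_le.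
  by apply: cmfunB; [exact: mgs|exact: cmfun_cst].
rewrite lee_pmul2l// le_eqVlt; apply/orP; left; apply/eqP.
by apply: eq_integral => s _; rewrite Normc.normcM normcR (ger0_norm (pkn_ge0 _ _)).
Qed.

(** One factor 2 comes from [normc_cint], the other from the triangle inequality; the kernel has
    mass 1. *)
Let del_leM n v : del n v <= 4 * M.
Proof.
rewrite -lee_fin; apply: (le_trans (del_le n v)).
apply: (@le_trans _ _ (2%:E * \int[mu]_s ((2 * M)%:E * (pkn n s)%:E))%E).
  rewrite lee_pmul2l//; apply: ge0_le_integral => //.
  - by move=> s _; rewrite lee_fin mulr_ge0 ?normc_ge0 ?pkn_ge0.
  - by apply/measurable_EFinP; apply: measurable_funM; [exact: mdifl|exact:
      measurable_pkn].
  - by apply/measurable_EFinP; apply: measurable_funM => //; exact: measurable_pkn.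
  - by move=> s _; rewrite -EFinM lee_fin ler_wpM2r ?pkn_ge0.
rewrite ge0_integralZl//; last 3 first.
- by apply/measurable_EFinP; exact: measurable_pkn.
- by move=> s _; rewrite lee_fin pkn_ge0.
- by rewrite lee_fin mulr_ge0.
by rewrite ge0_integral_pkn1 mule1 -EFinM lee_fin; have := M0; lra.
Qed.

(** Tonelli exchanges [v] and [s], which bounds the L^1 error by an average against [pk] of L^1
    distances between [g] and its translates. *)
Let del_int n : (\int[mu]_v (del n v)%:E <=
  2%:E * \int[mu]_s ((\int[mu]_v (dif v (n.+1%:R^-1 *: s))%:E) * (pk s)%:E))%E.
Proof.
have mdp : measurable_fun [set: 'rV[R]_d * 'rV[R]_d] (fun p => (dif p.1 p.2 * pkn n
    p.2)%:E).
  apply/measurable_EFinP; apply: measurable_funM => //.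
  apply: (measurableT_comp (measurable_pkn n)); exact: measurable_snd.
have dp0 v s : (0 <= (dif v s * pkn n s)%:E)%E.
  by rewrite lee_fin mulr_ge0 ?normc_ge0 ?pkn_ge0.
have mI : measurable_fun [set: 'rV[R]_d] (fun s => \int[mu]_v (dif v s)%:E)%E.
  apply: (measurable_fun_fubini_tonelli_G (m1 := lebesgue_rV d) (fun p => (dif p.1
      p.2)%:E)).
    exact/measurable_EFinP.
  by move=> p; rewrite lee_fin normc_ge0.
apply: (@le_trans _ _ (\int[mu]_v (2%:E * \int[mu]_s (dif v s * pkn n s)%:E))%E).
  have mFF : measurable_fun [set: 'rV[R]_d] (fun v => \int[mu]_s (dif v s * pkn n
      s)%:E)%E.
    apply: (measurable_fun_fubini_tonelli_F (m2 := lebesgue_rV d) (fun p => (dif p.1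
        p.2 * pkn n p.2)%:E)) => //.
  apply: ge0_le_integral => //.
  - by move=> v _; rewrite lee_fin normc_ge0.
  - apply/measurable_EFinP; apply: measurable_normc; apply: cmfunB => //.
    by apply: cmeasurable_fourierL1; case: (L1_cutoff n).
  - exact: measurable_funeM.
have mFF : measurable_fun [set: 'rV[R]_d] (fun v => \int[mu]_s (dif v s * pkn n s)%:E)%E.
  apply: (measurable_fun_fubini_tonelli_F (m2 := lebesgue_rV d) (fun p => (dif p.1 p.2
      * pkn n p.2)%:E)) => //.
rewrite ge0_integralZl//; last by move=> v _; exact: integral_ge0.
rewrite lee_pmul2l//.
rewrite (fubini_tonelli (m1 := lebesgue_rV d) (m2 := lebesgue_rV d)
   (fun p => (dif p.1 p.2 * pkn n p.2)%:E))//=.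
under eq_integral => s _.
  under eq_integral do rewrite EFinM.
  rewrite ge0_integralZr//; last 3 first.
  - by apply/measurable_EFinP; exact: mdifr.
  - by move=> v _; rewrite lee_fin normc_ge0.
  - by rewrite lee_fin pkn_ge0.
  over.
rewrite (ge0_integral_pkn n (h := fun s => \int[mu]_v (dif v s)%:E)%E)//.
by move=> s; apply: integral_ge0 => v _; rewrite lee_fin normc_ge0.
Qed.

(** The L^1 modulus of continuity of [g]. *)
Let I s : \bar R := (\int[mu]_v (dif v s)%:E)%E.

Let I_ge0 s : (0 <= I s)%E.
Proof. by apply: integral_ge0 => v _; rewrite lee_fin normc_ge0. Qed.

Let I_le s : (I s <= A%:E)%E.
Proof.
have gy : (\int[mu]_w (N (g w))%:E < +oo)%E by case: g1.
have mNg : measurable_fun [set: 'rV[R]_d] (fun w => (N (g w))%:E).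
  by apply/measurable_EFinP/measurable_normc.
have g0 : (0 <= \int[mu]_w (N (g w))%:E)%E.
  by apply: integral_ge0 => w _; rewrite lee_fin normc_ge0.
rewrite /A fineK; last by rewrite ge0_fin_numE ?mule_ge0// lte_mul_pinfty// ge0_fin_numE.
apply: (@le_trans _ _ (\int[mu]_v ((N (g (v + s)))%:E + (N (g v))%:E))%E).
  apply: ge0_le_integral => //.
  - by move=> v _; rewrite lee_fin normc_ge0.
  - by apply/measurable_EFinP; exact: mdifr.
  - apply: emeasurable_funD => //.
    exact: (measurableT_comp mNg (measurable_rV_shift s)).
  - by move=> v _; rewrite -EFinD lee_fin /dif [s + v]addrC (le_trans (le_normcD _
      _))// normcN.
rewrite ge0_integralD//; last 3 first.
- by move=> v _; rewrite lee_fin normc_ge0.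
- exact: (measurableT_comp mNg (measurable_rV_shift s)).
- by move=> v _; rewrite lee_fin normc_ge0.
rewrite (@ge0_integral_rV_shift _ _ s (fun v => (N (g v))%:E))//.
  by rewrite (_ : 2%:E = 1 + 1)%E// ge0_muleDl// !mul1e.
by move=> v; rewrite lee_fin normc_ge0.
Qed.

Let mI : measurable_fun [set: 'rV[R]_d] I.
Proof.
apply: (measurable_fun_fubini_tonelli_G (m1 := lebesgue_rV d) (fun p => (dif p.1
    p.2)%:E)).
  exact/measurable_EFinP.
by move=> p; rewrite lee_fin normc_ge0.
Qed.

Let I_cvg0 s : (fun n => I (n.+1%:R^-1 *: s)) @ \oo --> 0%E.
Proof.
have ir := cvg_L1_shift s (cL1_Re g1); have ii := cvg_L1_shift s (cL1_Im g1).
apply: cvge0_le (cvge0D ir ii) => n; rewrite I_ge0/=.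
have mN (h : 'rV[R]_d -> R) : measurable_fun [set: _] h ->
    measurable_fun [set: 'rV[R]_d] (fun x => `|(h (x + n.+1%:R^-1 *: s) - h x)%:E|%E).
  move=> mh; apply: measurableT_comp => //; apply/measurable_EFinP.
  by apply: measurable_funB => //; exact: (measurableT_comp mh (measurable_rV_shift _)).
have [mr mi] := mg.
rewrite -ge0_integralD//; last 2 first.
- exact: mN.
- exact: mN.
apply: ge0_le_integral => //.
- by move=> v _; rewrite lee_fin normc_ge0.
- by apply/measurable_EFinP; exact: mdifr.
- by apply: emeasurable_funD; exact: mN.
- move=> v _; rewrite -EFinD lee_fin /dif [_ *: s + v]addrC (le_trans (normc_le _))//.
  by case: (g (v + n.+1%:R^-1 *: s)) (g v) => a b [].
Qed.

Let D n : \bar R := (\int[mu]_s (I (n.+1%:R^-1 *: s) * (pk s)%:E))%E.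

Let Apk : mu.-integrable [set: _] (fun s => A%:E * (pk s)%:E)%E.
Proof. by apply: integrableZl => //; case: (@integral_pk R d). Qed.

Let D_cvg0 : D @ \oo --> 0%E.
Proof.
apply: (@dominated_cvge0 _ _ _ mu (fun n s => I (n.+1%:R^-1 *: s) * (pk s)%:E)%E _ _ Apk).
- move=> n; apply: emeasurable_funM; last by apply/measurable_EFinP; exact: measurable_pk.
  exact: (measurableT_comp mI (measurable_rV_scale _)).
- move=> n s; rewrite mule_ge0 ?lee_fin ?pk_ge0//=.
  by rewrite lee_wpmul2r// lee_fin pk_ge0.
- apply: nearW => s; under eq_fun do rewrite muleC.
  by apply: cvge0Z; exact: I_cvg0.
Qed.

Let D_fin n : (D n < +oo)%E.
Proof.
have /integrableP[_] := Apk; apply: le_lt_trans.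
apply: ge0_le_integral => //.
- by move=> s _; rewrite mule_ge0// lee_fin pk_ge0.
- apply: emeasurable_funM; last by apply/measurable_EFinP; exact: measurable_pk.
  exact: (measurableT_comp mI (measurable_rV_scale _)).
- by apply: measurableT_comp => //; case/integrableP: Apk.
- move=> s _; apply: (@le_trans _ _ (A%:E * (pk s)%:E)%E); last exact: lee_abs.
  by rewrite lee_wpmul2r// lee_fin pk_ge0.
Qed.

Let dl n v : R[i] := fourierL1 (cutoff n) v - g v.

Let mdel n : cmeasurable (dl n).
Proof.
by apply: cmfunB => //; apply: cmeasurable_fourierL1; case: (L1_cutoff n).
Qed.

(** |error|^2 <= 4M |error| by [del_leM], and the remaining factor 2 is that of [del_int]. *)
Let sqn_le n : (sqnormL2 (dl n) <= (4 * M * 2)%:E * D n)%E.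
Proof.
rewrite EFinM -muleA.
apply: (@le_trans _ _ (\int[mu]_v ((4 * M)%:E * (del n v)%:E))%E).
  apply: ge0_le_integral => //.
  - by move=> v _; rewrite lee_fin sqr_ge0.
  - by apply/measurable_EFinP; apply: measurable_normc_sqr; exact: mdel.
  - by apply/measurable_EFinP; apply: measurable_funM => //; exact: (measurable_normc
      (mdel n)).
  - by move=> v _; rewrite -EFinM lee_fin expr2 ler_wpM2r ?normc_ge0//; exact: del_leM.
rewrite ge0_integralZl//; last 3 first.
- by apply/measurable_EFinP; exact: (measurable_normc (mdel n)).
- by move=> v _; rewrite lee_fin normc_ge0.
- by rewrite lee_fin mulr_ge0.
by rewrite lee_wpmul2l ?lee_fin ?mulr_ge0//; exact: del_int.
Qed.

Let L2_del n : L2 (dl n).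
Proof.
split; first exact: mdel.
apply: (le_lt_trans (sqn_le n)); apply: lte_mul_pinfty => //.
by rewrite lee_fin !mulr_ge0.
Qed.

Lemma cvg_fourierL1_cutoff : cvgL2 (fun n => fourierL1 (cutoff n)) g.
Proof.
apply: cvge0_le (cvge0Z (4 * M * 2) D_cvg0) => n.
by rewrite sqnormL2_ge0/=; exact: sqn_le.
Qed.

Let g2 : L2 g. Proof. exact: (L2_bounded g1 gM). Qed.

Let L2_fourierL1_cutoff n : L2 (fourierL1 (cutoff n)).
Proof.
by have := L2D (L2_del n) g2; under eq_fun do rewrite subrK.
Qed.

(** Plancherel's identity comes from computing the limit of [a] twice. Monotone convergence gives
    the squared norm of the inverse transform, finite or not; the multiplication formula turns [a n]
    into the pairing of [g] with the transform of [cutoff n], which tends to the squared norm of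
    [g]. Square integrability of the inverse transform is thus a result of the argument. *)
Let a n : \bar R := (\int[mu]_x (gamn n x * N (ifourierL1 g x) ^+ 2)%:E)%E.

Let mgN n : measurable_fun [set: 'rV[R]_d] (fun x => gamn n x * N (ifourierL1 g x) ^+ 2).
Proof. by apply: measurable_funM; [exact: measurable_gamn|exact: measurable_normc_sqr].
    Qed.

Let a_ge0 n : (0 <= a n)%E.
Proof.
by apply: integral_ge0 => x _; rewrite lee_fin mulr_ge0 ?sqr_ge0//; exact/ltW/gamn_gt0.
Qed.

Let a_fin n : (a n < +oo)%E.
Proof.
have [_ c1] := L1_gamn n.
apply: (@le_lt_trans _ _ (\int[mu]_x ((A ^+ 2)%:E * (N (gamn n x)%:C)%:E))%E).
  apply: ge0_le_integral => //.
  - by move=> x _; rewrite lee_fin mulr_ge0 ?sqr_ge0//; exact/ltW/gamn_gt0.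
  - exact/measurable_EFinP.
  - apply/measurable_EFinP; apply: measurable_funM => //.
    by apply: measurable_normc; apply: cmfun_real; exact: measurable_gamn.
  - move=> x _; rewrite -EFinM lee_fin normcR ger0_norm; last exact/ltW/gamn_gt0.
    rewrite mulrC ler_wpM2r//; first exact/ltW/gamn_gt0.
    by rewrite ler_sqr ?nnegrE ?normc_ge0// (le_trans (normc_ge0 (ifourierL1 g x))).
rewrite ge0_integralZl//.
- by rewrite lte_mul_pinfty// lee_fin sqr_ge0.
- by apply/measurable_EFinP; apply: measurable_normc; apply: cmfun_real; exact:
    measurable_gamn.
- by move=> x _; rewrite lee_fin normc_ge0.
- by rewrite lee_fin sqr_ge0.
Qed.

Let a_innerL2 n : innerL2 g (fourierL1 (cutoff n)) = (fine (a n))%:C.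
Proof.
rewrite -innerL2_ifourierL1// -(cint_real mu (fun x => gamn n x * N (ifourierL1 g x) ^+
    2)).
apply: eq_cint => x; rewrite /cutoff conjcM conjc_real mulrCA mulcJ.
by rewrite -rmorphM.
Qed.

Let a_cvg_g : a @ \oo --> sqnormL2 g.
Proof.
have [_ gy] := g2.
have gf : sqnormL2 g \is a fin_num by rewrite ge0_fin_numE ?sqnormL2_ge0.
rewrite -(fineK gf); apply/fine_cvgP; split.
  by apply: nearW => n; rewrite ge0_fin_numE.
apply/cvgrPdist_lt => e e0.
pose G := fine (sqnormL2 g).
have G0 : 0 <= G by rewrite fine_ge0 ?sqnormL2_ge0.
(* Balances the two terms of [innerL2_bound]: each is at most e/2. The [+ 1] covers the case
   [G = 0]. *)
pose t := e / 2 / (G + 1).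
have t0 : 0 < t by rewrite divr_gt0 ?divr_gt0// ltr_wpDl.
have := cvg_fourierL1_cutoff; move=> /cvge0P H.
have {}H := H (fun n => sqnormL2_ge0 _) (t * (e / 2)).
have {H} : \forall n \near \oo, (sqnormL2 (dl n) < (t * (e / 2))%:E)%E.
  by apply: H; apply: mulr_gt0 => //; exact: divr_gt0.
apply: filterS => n Hn /=.
have -> : `|fine (sqnormL2 g) - fine (a n)| =
    N (innerL2 g (dl n)).
  by rewrite innerL2B// innerL2_diag a_innerL2 -rmorphB normcR distrC.
have [_] := innerL2_bound t0 g2 (L2_del n).
rewrite -lte_fin => /le_lt_trans; apply.
apply: (@le_lt_trans _ _ ((t * G)%:E + t^-1%:E * sqnormL2 (dl n))%E).
  by rewrite -[X in (t%:E * X)%E](fineK gf) -EFinM.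
rewrite -(fineK (_ : sqnormL2 (dl n) \is a fin_num)); last first.
  by rewrite ge0_fin_numE ?sqnormL2_ge0// (lt_trans Hn)// ltry.
rewrite -EFinM -EFinD lte_fin.
have tG : t * G <= e / 2.
  rewrite /t mulrAC ler_pdivrMr; last by rewrite ltr_wpDl.
  by rewrite ler_pM2l ?divr_gt0// lerDl.
have : fine (sqnormL2 (dl n)) < t * (e / 2).
  rewrite -lte_fin fineK//.
  by rewrite ge0_fin_numE ?sqnormL2_ge0// (lt_trans Hn)// ltry.
rewrite mulrC -ltr_pdivrMr// mulrC => H.
rewrite [e]splitr; exact: ler_ltD.
Qed.

(** Written as a single exponential, the damping is visibly nondecreasing in [n] with limit 1. *)
Let gamnE n x : gamn n x = expR (- (n.+1%:R^-1 * (2 * pi * \sum_(i < d) `|x ord0 i|))).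
Proof.
rewrite !mulr_sumr -sumrN expR_sum; apply: eq_bigr => i _; rewrite /gam1 mxE normrM.
by rewrite [`|n.+1%:R^-1|]ger0_norm ?invr_ge0//; congr (expR (- _)); ring.
Qed.

Let gamn_cvg x : (fun n => gamn n x) @ \oo --> (1 : R).
Proof.
under eq_fun do rewrite gamnE.
set S := 2 * pi * _.
have H : (fun n => - (n.+1%:R^-1 * S)) @ \oo --> (0 : R).
  rewrite -oppr0; apply: cvgN; rewrite -(mul0r S).
  by apply: cvgM; [exact: cvg_harmonic|exact: cvg_cst].
by have := cvg_comp _ _ H (@continuous_expR R 0); rewrite expR0.
Qed.

Let gamn_nd x : {homo (fun n => gamn n x) : n m / (n <= m)%N >-> n <= m}.
Proof.
move=> n m nm; rewrite !gamnE ler_expR lerN2 ler_wpM2r//.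
  by rewrite !mulr_ge0 ?pi_ge0// sumr_ge0.
by rewrite lef_pV2 ?posrE// ler_nat.
Qed.

Let a_cvg_f : a @ \oo --> sqnormL2 (ifourierL1 g).
Proof.
have := @cvg_monotone_convergence _ _ _ mu _ measurableT
  (fun n x => (gamn n x * N (ifourierL1 g x) ^+ 2)%:E).
rewrite (_ : (\int[mu]_x limn _)%E = sqnormL2 (ifourierL1 g)).
  apply.
  - by move=> n; exact/measurable_EFinP.
  - by move=> n x _; rewrite lee_fin mulr_ge0 ?sqr_ge0//; exact/ltW/gamn_gt0.
  - by move=> x _ n m nm; rewrite lee_fin ler_wpM2r ?sqr_ge0//; exact: gamn_nd.
apply: eq_integral => x _; apply/cvg_lim => //.
apply: cvg_EFin; first exact: nearW.
rewrite -[X in _ --> X]mul1r; apply: cvgM; [exact: gamn_cvg|exact: cvg_cst].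
Qed.

Lemma sqnormL2_ifourierL1 : sqnormL2 (ifourierL1 g) = sqnormL2 g.
Proof. by rewrite -(cvg_lim _ a_cvg_f)// (cvg_lim _ a_cvg_g). Qed.

Lemma L2_ifourierL1 : L2 (ifourierL1 g).
Proof. by split => //; rewrite sqnormL2_ifourierL1; case: g2. Qed.

(** Dominated convergence with the squared modulus of the inverse transform as majorant, integrable
    by the Plancherel identity just obtained. *)
Lemma cvg_cutoff : cvgL2 cutoff (ifourierL1 g).
Proof.
have [_ fy] := L2_ifourierL1.
have fi : mu.-integrable [set: _] (fun x => (N (ifourierL1 g x) ^+ 2)%:E).
  apply/integrableP; split; first exact/measurable_EFinP/measurable_normc_sqr.
  by under eq_integral do rewrite /= ger0_norm ?sqr_ge0//; exact: fy.
have E n x : N (cutoff n x - ifourierL1 g x) ^+ 2 =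
    (1 - gamn n x) ^+ 2 * N (ifourierL1 g x) ^+ 2.
  rewrite /cutoff -[X in _ - X]mul1r -mulrBl Normc.normcM exprMn -rmorphB normcR.
  by rewrite real_normK ?num_real// -sqrrN opprB.
apply: (@dominated_cvge0 _ _ _ mu _ _ _ fi).
- move=> n; apply/measurable_EFinP/measurable_normc_sqr; apply: cmfunB => //.
  by case: (L1_cutoff n).
- move=> n x; rewrite !lee_fin sqr_ge0/= E ler_piMl ?sqr_ge0//.
  rewrite expr_le1// ?subr_ge0 ?gamn_le1// lerBlDr lerDl.
  exact/ltW/gamn_gt0.
- apply: nearW => x; under eq_fun do rewrite E.
  apply: cvg_EFin; first exact: nearW.
  rewrite -[X in _ --> X](mul0r (N (ifourierL1 g x) ^+ 2)).
  apply: cvgM; last exact: cvg_cst.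
  have : (fun n => 1 - gamn n x) @ \oo --> (0 : R).
    rewrite -(subrr (1 : R)); apply: cvgB; [exact: cvg_cst|exact: gamn_cvg].
  by move=> H; rewrite -[X in _ --> X](mulr0 0); exact: cvgM.
Qed.

Theorem is_fourierL2_ifourierL1 : is_fourierL2 (ifourierL1 g) g.
Proof.
split; [exact: L2_ifourierL1|exact: g2|exists cutoff; split].
- by move=> n; split.
- exact: cvg_cutoff.
- exact: cvg_fourierL1_cutoff.
Qed.

End inversion.

(** * Parseval's identity and uniqueness of the transform *)

Section fourier_pairing.
Context {R : realType} {d : nat}.
Local Notation mu := (@lebesgue_rV R d : {measure set 'rV[R]_d -> \bar R}).
Local Notation N := (@Normc.normc R).
Implicit Types f g h phi psi : 'rV[R]_d -> R[i].

(** For each approximant [u n] the identity is the multiplication formula. It survives the limit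
    because pairing with a fixed L^2 function is continuous on L^2, and [ifourierL1 g] has the same
    norm as [g]. *)
Lemma innerL2_fourierL2 g (M : R) h phi : L1 g -> (forall x, N (g x) <= M) ->
  is_fourierL2 h phi -> innerL2 (ifourierL1 g) h = innerL2 g phi.
Proof.
move=> g1 gM [h2 phi2 [u [u12 uh uphi]]].
have g2 := L2_bounded g1 gM; have f2 := L2_ifourierL1 g1 gM.
have sf := sqnormL2_ifourierL1 g1 gM.
pose G := fine (sqnormL2 g).
have gf : sqnormL2 g \is a fin_num by rewrite ge0_fin_numE ?sqnormL2_ge0//; case: g2.
have G0 : 0 <= G by rewrite fine_ge0 ?sqnormL2_ge0.
apply/eqP; rewrite -subr_eq0; apply/eqP/(@Normc.eq0_normc R)/eqP.
rewrite eq_le normc_ge0 andbT; apply/ler_addgt0Pr => e e0; rewrite add0r.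
(* There are two error pairings, and [innerL2_bound] splits each into two terms of size at most
   e/4. *)
pose t := e / 4 / (G + 1).
have t0 : 0 < t by rewrite divr_gt0 ?divr_gt0// ltr_wpDl.
have te0 : 0 < t * (e / 4) by apply: mulr_gt0 => //; exact: divr_gt0.
have [n [un1 un2]] : exists n, (sqnormL2 (fun x => (u n x - h x)%R) < (t * (e /
    4))%:E)%E /\
   (sqnormL2 (fun x => (fourierL1 (u n) x - phi x)%R) < (t * (e / 4))%:E)%E.
  move: uh => /cvge0P H1; have {}H1 := H1 (fun n => sqnormL2_ge0 _) _ te0.
  move: uphi => /cvge0P H2; have {}H2 := H2 (fun n => sqnormL2_ge0 _) _ te0.
  have [n _ H] := filterI H1 H2.
  by exists n; exact: (H n (leqnn n)).
have [u1 u2] := u12 n.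
have v2 : L2 (fun x => fourierL1 (u n) x - phi x).
  split; last by rewrite (lt_trans un2)// ltry.
  by apply: cmfunB; [apply: cmeasurable_fourierL1; case: u1|case: phi2].
have w2 : L2 (fourierL1 (u n)).
  rewrite (_ : fourierL1 (u n) = (fun x => fourierL1 (u n) x - phi x + phi x)).
    exact: L2D.
  by apply/funext => x; rewrite subrK.
have E : innerL2 (ifourierL1 g) h - innerL2 g phi =
    innerL2 g (fun x => fourierL1 (u n) x - phi x) -
    innerL2 (ifourierL1 g) (fun x => u n x - h x).
  by rewrite !innerL2B// (innerL2_ifourierL1 g1 u1); ring.
have B k k' : L2 k -> L2 k' -> sqnormL2 k = sqnormL2 g ->
    (sqnormL2 k' < (t * (e / 4))%:E)%E -> N (innerL2 k k') <= e / 2.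
  move=> k2 k'2 kg k'e; have [_] := innerL2_bound t0 k2 k'2.
  rewrite -lee_fin => /le_trans; apply; rewrite kg.
  rewrite -(fineK gf) -EFinM.
  apply: (@le_trans _ _ ((t * G)%:E + t^-1%:E * (t * (e / 4))%:E)%E).
    by rewrite leeD2l// lee_wpmul2l ?lee_fin ?invr_ge0 ?ltW.
  rewrite -EFinM -EFinD lee_fin mulKf ?gt_eqF//.
  have : t * G <= e / 4.
    rewrite /t mulrAC ler_pdivrMr; last by rewrite ltr_wpDl.
    by rewrite ler_pM2l ?divr_gt0// lerDl.
  lra.
rewrite E (le_trans (le_normcD _ _))// normcN [e]splitr lerD//.
- exact: B.
- by apply: B => //; exact: L2B.
Qed.

(** The translation is moved from [h] to the inverse transform, where it is a modulation of [g]; the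
    modulated function is still bounded and integrable, so Parseval applies to it. *)
Lemma innerL2_translate g (M : R) h phi (a : 'rV[R]_d) : L1 g ->
  (forall x, N (g x) <= M) -> is_fourierL2 h phi ->
  innerL2 (ifourierL1 g) (translate a h) =
  innerL2 (fun w => g w * expi (2 * pi * dotp w a)) phi.
Proof.
move=> g1 gM hphi; have [[mh _] _ _] := hphi.
have ge1 := L1_expi_dotpl (2 * pi) a g1.
have geM x : N (g x * expi (2 * pi * dotp x a)) <= M.
  by rewrite Normc.normcM normc_expi mulr1.
rewrite -(innerL2_fourierL2 ge1 geM hphi).
rewrite /innerL2 -[LHS](cintegral_shift a).
  apply: eq_cint => x; rewrite /translate addrK; congr (_ * _).
  apply: eq_cint => w; rewrite -[RHS]mulrA -expiD; congr (_ * expi _).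
  by rewrite -mulrDr dotpC dotpDl addrC !(dotpC w).
apply: cmfunM; first by apply: cmeasurable_ifourierL1; case: g1.
by apply: cmfunJ; apply: (cmfun_comp mh); exact: measurable_rV_shift.
Qed.

(** Bridges two representatives: membership in [paley_wiener] supplies one that vanishes off [E],
    whereas continuity concerns another. By Parseval both pair alike with every bounded integrable
    function. *)
Lemma is_fourierL2_ae_unique h phi psi : is_fourierL2 h phi -> is_fourierL2 h psi ->
  {ae mu, forall w, phi w = psi w}.
Proof.
move=> hphi hpsi.
have [_ phi2 _] := hphi; have [_ psi2 _] := hpsi.
pose D w := phi w - psi w; have D2 : L2 D by exact: L2B.
(* Since x <= 1 + x^2, multiplying [D] by this weight leaves a function of modulus at most [gam],
   although [D] is only known to be in L^2. *)
pose chi w : R := gam w * (1 + N (D w) ^+ 2)^-1.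
have mD : cmeasurable D by case: D2.
have chi0 w : 0 < chi w.
  by rewrite mulr_gt0 ?gam_gt0// invr_gt0 ltr_pwDl// sqr_ge0.
have mchi : measurable_fun [set: 'rV[R]_d] chi.
  apply: measurable_funM; first exact: measurable_gam.
  apply: (measurableT_comp (continuous_measurable_fun (@continuous_oneDsqrV R))).
  exact: measurable_normc.
(* [k] is bounded and integrable, and pairs with [D] to a positive weight times [|D|^2]. *)
pose k w := D w * (chi w)%:C.
have Nk w : N (k w) <= gam w.
  rewrite Normc.normcM normcR (gtr0_norm (chi0 w)) /chi mulrCA.
  rewrite ler_piMr//; first exact/ltW/gam_gt0.
  rewrite ler_pdivrMr ?mul1r ?ltr_pwDl ?sqr_ge0//.
  have := sqr_ge0 (N (D w) - 1); have := normc_ge0 (D w); nra.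
have k1 : L1 k.
  apply: (cL1_le _ Nk); last exact: integrable_gam.
  by apply: cmfunM => //; exact: cmfun_real.
have kM w : N (k w) <= 1 by rewrite (le_trans (Nk w))// gam_le1.
have k2 := L2_bounded k1 kM.
have : innerL2 k D = 0.
  by rewrite innerL2B// -(innerL2_fourierL2 k1 kM hphi) -(innerL2_fourierL2 k1 kM hpsi)
      subrr.
have kD w : k w * conjc (D w) = (chi w * N (D w) ^+ 2)%:C.
  by rewrite /k mulrAC mulcJ -rmorphM mulrC.
have [kDi _] := innerL2_bound ltr01 k2 D2.
rewrite (_ : innerL2 k D = (\int[mu]_w (chi w * N (D w) ^+ 2))%:C); last first.
  by rewrite -cint_real; exact: eq_cint.
move=> [] /eqP.
have mF : measurable_fun [set: 'rV[R]_d] (fun w => (chi w * N (D w) ^+ 2)%:E).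
  by apply/measurable_EFinP; apply: measurable_funM => //; exact: measurable_normc_sqr.
have F0 w : 0 <= chi w * N (D w) ^+ 2 by rewrite mulr_ge0 ?sqr_ge0 ?ltW.
rewrite /Rintegral fine_eq0; last first.
  apply: integrable_fin_num => //.
  apply: eq_integrable (cL1_Re kDi) => // w _.
  by rewrite /comp kD.
move=> /eqP I0.
have : (\int[mu]_w `|(chi w * N (D w) ^+ 2)%:E| = 0)%E.
  by rewrite -I0; apply: eq_integral => w _; rewrite gee0_abs ?lee_fin.
move=> /(ae_eq_integral_abs _ measurableT mF).
apply: filterS => w /(_ I) [] /eqP.
rewrite mulf_eq0 (gt_eqF (chi0 w))/= expf_eq0/= => /eqP/(@Normc.eq0_normc R)/eqP.
by rewrite subr_eq0 => /eqP.
Qed.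

End fourier_pairing.

(** * The two cubes *)

Section complex_continuity.
Context {R : realType} {T : topologicalType}.
Local Notation N := (@Normc.normc R).

(** The norm of [R[i]^o] takes its values in [R[i]]; here continuity is restated with the
    real-valued [normc]. *)
Lemma near_normc (phi : T -> R[i]) (w : T) (e : R) :
  {for w, continuous (phi : T -> R[i]^o)} -> 0 < e ->
  \forall x \near w, N (phi w - phi x) < e.
Proof.
move=> cphi e0.
have e0C : 0 < e%:C by rewrite ltcR.
move/cvgrPdist_lt : cphi => /(_ _ e0C); apply: filterS => x.
rewrite -ltcR.
by case: (phi w - phi x) => a b.
Qed.

Lemma continuous_normc (phi : T -> R[i]) : continuous (phi : T -> R[i]^o) ->
  continuous (fun x => N (phi x)).
Proof.
move=> cphi w; apply/cvgrPdist_lt => e e0.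
apply: filterS (near_normc (cphi w) e0) => x; apply: le_lt_trans.
rewrite ler_norml; apply/andP; split.
  rewrite lerNl opprB lerBlDr normcB (le_trans _ (le_normcD _ _))//.
  by rewrite subrK.
by rewrite lerBlDr (le_trans _ (le_normcD _ _))// subrK.
Qed.

End complex_continuity.

Section box.
Context {R : realType} {d : nat}.
Local Notation mu := (@lebesgue_rV R d : {measure set 'rV[R]_d -> \bar R}).
Local Notation N := (@Normc.normc R).

(** The open ball of the sup norm when [0 < r], spelled out by coordinates so that its measure is a
    product of lengths. *)
Definition box (w : 'rV[R]_d) (r : R) : set 'rV[R]_d :=
  [set x | forall i, (`]w ord0 i - r, w ord0 i + r[%classic : set R) (x ord0 i)].

Lemma measurable_box w r : measurable (box w r).
Proof.
rewrite (_ : box w r = \bigcap_(i in [set: 'I_d])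
    ((fun x : 'rV[R]_d => x ord0 i) @^-1` (`]w ord0 i - r, w ord0 i + r[%classic : set
        R))); last first.
  by apply/seteqP; split=> x /= Ax i => [_|]; exact: Ax.
apply: fin_bigcap_measurable => // i _; rewrite -[X in measurable X]setTI.
apply: (@measurable_rV_coord _ R d i measurableT); exact: measurable_itv.
Qed.

Lemma lebesgue_rV_box w r : 0 < r -> mu (box w r) = ((2 * r) ^+ d)%:E.
Proof.
move=> r0.
transitivity (\prod_(i < d) @lebesgue_measure R [set` `]w ord0 i - r, w ord0 i + r[%R])%E.
  apply: (@lebesgue_rV_rectangle R d (fun i => [set` `]w ord0 i - r, w ord0 i + r[%R]))
      => i.
  exact: measurable_itv.
rewrite (eq_bigr (fun=> (2 * r)%:E)).
  by rewrite prodEFin prodr_const card_ord.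
move=> i _; rewrite lebesgue_measure_itv/= lte_fin ifT; last by lra.
by rewrite -EFinB; congr EFin; ring.
Qed.

Lemma coord_le_norm (x : 'rV[R]_d) i : `|x ord0 i| <= `|x|.
Proof.
rewrite [leRHS]/Num.norm/= mx_normrE; apply/bigmax_geP; right => /=.
by exists (ord0, i).
Qed.

Lemma box_nbhs (P : set 'rV[R]_d) w : (\forall x \near w, P x) ->
  exists2 r, 0 < r & forall x, box w r x -> P x.
Proof.
move=> /nbhs_ballP[r r0 H]; exists r => // x xw; apply: H; split => // i j.
rewrite !ord1; have := xw j; rewrite /= in_itv/= => /andP[? ?].
by rewrite /ball/= ltr_norml; apply/andP; split; lra.
Qed.

Lemma box_le w r r' : r <= r' -> box w r `<=` box w r'.
Proof.
move=> rr x xw i; have := xw i; rewrite /= !in_itv/= => /andP[? ?].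
by apply/andP; split; lra.
Qed.

Lemma box_shift (w v x : 'rV[R]_d) r : box w r (x + v) <-> box (w - v) r x.
Proof.
split=> H i; have := H i; rewrite /= !in_itv/= !mxE => /andP[? ?];
  apply/andP; split; lra.
Qed.

(** The intermediate value theorem along the segment from [w0] to the zero [w2]. *)
Lemma normc_IVT (phi : 'rV[R]_d -> R[i]) (w0 w2 : 'rV[R]_d) (y : R) :
  continuous (phi : 'rV[R]_d -> R[i]^o) -> phi w2 = 0 -> 0 <= y <= N (phi w0) ->
  exists w1, N (phi w1) = y.
Proof.
move=> cphi p2 /andP[y0 y1].
pose f (t : R) := N (phi (w0 + t *: (w2 - w0))).
have cf : continuous f.
  apply: (@continuous_normc _ _ (fun t : R => phi (w0 + t *: (w2 - w0)))).
  move=> t; apply: (@continuous_comp _ _ _ (fun t : R => w0 + t *: (w2 - w0)) (phi : _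
      -> R[i]^o)).
    apply: cvgD; first exact: cvg_cst.
    apply: cvgZl; exact: cvg_id.
  exact: cphi.
have f0 : f 0 = N (phi w0) by rewrite /f scale0r addr0.
have f1 : f 1 = 0 by rewrite /f scale1r addrC subrK p2 Normc.normc0.
have [||c _ fc] := @IVT _ f 0 1 y ler01.
- exact: continuous_subspaceT.
- by rewrite f0 f1 ge_min le_max y0 y1 orbT.
by exists (w0 + c *: (w2 - w0)).
Qed.

Lemma cmfun_indic (B : set 'rV[R]_d) (f : 'rV[R]_d -> R[i]) : measurable B ->
  cmeasurable f -> cmeasurable (fun x => (\1_B x)%:C * f x).
Proof.
by move=> mB mf; apply: cmfunM => //; apply: cmfun_real; exact: measurable_indic.
Qed.

Lemma box_L1 (f : 'rV[R]_d -> R[i]) (M : R) w r : 0 < r -> cmeasurable f ->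
  (forall x, box w r x -> N (f x) <= M) ->
  [/\ L1 (fun x => (\1_(box w r) x)%:C * f x),
      forall x, N ((\1_(box w r) x)%:C * f x) <= `|M| &
      (sqnormL2 (fun x => (\1_(box w r) x)%:C * f x)%R <= (M ^+ 2 * (2 * r) ^+ d)%:E)%E].
Proof.
move=> r0 mf fM.
have mB := measurable_box w r.
have bnd x : N ((\1_(box w r) x)%:C * f x) <= `|M| * \1_(box w r) x.
  rewrite Normc.normcM normcR ger0_norm// mulrC indicE.
  have [xB|xB] := pselect (box w r x).
    by rewrite mem_set// !mulr1 (le_trans (fM _ xB))// ler_norm.
  by rewrite memNset// !mulr0.
have iB : mu.-integrable [set: _] (EFin \o (\1_(box w r) : _ -> R)).
  apply/integrableP; split; first by apply/measurable_EFinP; exact: measurable_indic.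
  under eq_integral do rewrite /= ger0_norm//.
  by rewrite integral_indic// setIT [X in (X < _)%E](lebesgue_rV_box w r0) ltry.
split.
- apply: (cL1_le _ bnd); first exact: cmfun_indic.
  exact: (integrableZl _ _ iB).
- move=> x; by rewrite (le_trans (bnd x))// ler_piMr.
have -> : (M ^+ 2 * (2 * r) ^+ d)%:E =
    ((M ^+ 2)%:E * \int[mu]_x (\1_(box w r) x)%:E)%E.
  rewrite integral_indic// setIT EFinM; congr (_ * _)%E.
  exact/esym/lebesgue_rV_box.
rewrite -ge0_integralZl//; last 2 first.
- by apply/measurable_EFinP; exact: measurable_indic.
- by rewrite lee_fin sqr_ge0.
apply: ge0_le_integral => //.
- by move=> x _; rewrite lee_fin sqr_ge0.
- by apply/measurable_EFinP; apply: measurable_normc_sqr; exact: cmfun_indic.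
- by apply/measurable_EFinP; apply: measurable_funM => //; exact: measurable_indic.
- move=> x _; rewrite -EFinM lee_fin.
  have -> : M ^+ 2 * \1_(box w r) x = (`|M| * \1_(box w r) x) ^+ 2.
    rewrite exprMn real_normK ?num_real//; congr (_ * _).
    by rewrite indicE; case: (x \in box w r); rewrite ?expr1n ?expr0n.
  by rewrite ler_sqr ?nnegrE ?normc_ge0 ?bnd.
Qed.

End box.

(** * The frame inequalities on the Fourier side *)

Section frame.
Context {R : realType} {d : nat}.
Local Notation mu := (@lebesgue_rV R d : {measure set 'rV[R]_d -> \bar R}).
Local Notation N := (@Normc.normc R).
Implicit Types (g h phi : 'rV[R]_d -> R[i]) (E : set 'rV[R]_d).

Lemma sqnormL2_eq0_negligible E (g : 'rV[R]_d -> R[i]) : cmeasurable g -> sqnormL2 g =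
    0%E ->
  (forall w, E w -> g w <> 0) -> mu.-negligible E.
Proof.
move=> mg g0 Eg.
have mF : measurable_fun [set: 'rV[R]_d] (fun w => (N (g w) ^+ 2)%:E).
  by apply/measurable_EFinP/measurable_normc_sqr.
have : (\int[mu]_w `|(N (g w) ^+ 2)%:E| = 0)%E.
  by rewrite -g0; apply: eq_integral => w _; rewrite gee0_abs ?lee_fin ?sqr_ge0.
move=> /(ae_eq_integral_abs _ measurableT mF).
apply: negligibleS => w Ew /= /(_ I) [] /eqP.
by rewrite expf_eq0/= => /eqP/(@Normc.eq0_normc R); exact: Eg.
Qed.

Lemma innerL2_0r g phi : (forall w, phi w = 0) -> innerL2 g phi = 0.
Proof.
move=> p0; rewrite /innerL2 (_ : (fun x => _) = fun=> 0).
  by rewrite /cintegral/= /Rintegral integral0.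
by apply/funext => w; rewrite p0 conjc0 mulr0.
Qed.

(** The frame is tested on [ifourierL1 g], whose transform is [g]; Plancherel rewrites the norms and
    [innerL2_translate] the coefficients. *)
Lemma paley_wiener_frame E h phi (K : countType) (lam : K -> 'rV[R]_d) :
  is_fourierL2 h phi -> is_frame (paley_wiener E) (fun k => translate (lam k) h) ->
  exists A B : R, [/\ 0 < A, 0 < B & forall g (M : R), L1 g -> (forall x, N (g x) <= M) ->
    {ae mu, forall w, ~ E w -> g w = 0} ->
    (A%:E * sqnormL2 g <= \esum_(k in [set: K])
       (N (innerL2 (fun w => g w * expi (2 * pi * dotp w (lam k)))%R phi) ^+ 2)%:E
     <= B%:E * sqnormL2 g)%E].
Proof.
move=> hphi [_ [A [B [A0 B0 fr]]]]; exists A, B; split => // g M g1 gM g0.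
have PW : paley_wiener E (ifourierL1 g).
  by exists g; split => //; exact: (is_fourierL2_ifourierL1 g1 gM).
have := fr _ PW; rewrite (sqnormL2_ifourierL1 g1 gM).
rewrite (@eq_esum _ _ _ _ (fun k =>
   (N (innerL2 (fun w => g w * expi (2 * pi * dotp w (lam k)))%R phi) ^+ 2)%:E))//.
by move=> k _; rewrite (innerL2_translate _ g1 gM hphi).
Qed.

Section frame_main.
Variables (E : set 'rV[R]_d) (phi : 'rV[R]_d -> R[i]) (K : countType) (lam : K ->
    'rV[R]_d).
Variables (A B : R).
Hypotheses (d_gt0 : (0 < d)%N) (mE : lebesgue_measurable E) (bE : bounded_set E).
Hypotheses (E_nonnull : ~ mu.-negligible E) (cphi : continuous (phi : 'rV[R]_d ->
    R[i]^o)).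
Hypotheses (phi2 : L2 phi) (phiE : {ae mu, forall w, ~ E w -> phi w = 0}).
Hypotheses (A0 : 0 < A) (B0 : 0 < B).

Let coef g k := N (innerL2 (fun w => g w * expi (2 * pi * dotp w (lam k))) phi) ^+ 2.

Let S g : \bar R := (\esum_(k in [set: K]) (coef g k)%:E)%E.

Hypothesis frame_phi : forall g (M : R), L1 g -> (forall x, N (g x) <= M) ->
  {ae mu, forall w, ~ E w -> g w = 0} ->
  (A%:E * sqnormL2 g <= S g <= B%:E * sqnormL2 g)%E.

Let mphi : cmeasurable phi. Proof. by case: phi2. Qed.

Lemma frame_transform_neq0 : exists w0, phi w0 <> 0.
Proof.
apply: contrapT => /forallNP H.
have p0 w : phi w = 0 by apply: contrapT; exact: H.
(* [E] is only Lebesgue measurable, so the test function lives on a Borel set [D] equal to it up to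
   a null set; [gam] makes it integrable without any estimate on [D]. *)
have [D [mD ED]] := mE.
pose g w : R[i] := (\1_D w)%:C * (gam w)%:C.
have mg : cmeasurable g.
  by apply: cmfun_indic => //; apply: cmfun_real; exact: measurable_gam.
have Ng w : N (g w) <= gam w.
  rewrite Normc.normcM !normcR (gtr0_norm (gam_gt0 w)) ger0_norm//.
  by rewrite ler_piMl// ltW// gam_gt0.
have g1 : L1 g by apply: (cL1_le mg Ng); exact: integrable_gam.
have gM w : N (g w) <= 1 by rewrite (le_trans (Ng w))// gam_le1.
have gE : {ae mu, forall w, ~ E w -> g w = 0}.
  apply: negligibleS ED => w /= /not_implyP[Ew gw]; right; split => //.
  by apply: contrapT => Dw; apply: gw; rewrite /g indicE memNset// mul0r.
have /andP[+ _] := frame_phi g1 gM gE.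
rewrite (_ : S g = 0%E); last first.
  by apply: esum1 => k _; rewrite /coef innerL2_0r// Normc.normc0 expr0n.
move=> Ag; have g0 : sqnormL2 g = 0%E.
  apply/eqP; rewrite eq_le sqnormL2_ge0 andbT.
  by rewrite -(@lee_pmul2l _ A%:E)//= ?lte_fin// mule0.
apply: E_nonnull; apply: (negligibleS _ (negligibleU ED (@sqnormL2_eq0_negligible D g
    mg g0 _))).
  by move=> w Ew; have [Dw|Dw] := pselect (D w); [right|left; left].
move=> w Dw /(congr1 N) /eqP; rewrite Normc.normc0 /g indicE mem_set// mul1r normcR.
by rewrite normr_eq0 gt_eqF// gam_gt0.
Qed.

Lemma transform_has_zero : exists w2, phi w2 = 0.
Proof.
apply: contrapT => /forallNP H.
have [M [_ bM]] := bE.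
(* The first coordinate exceeds [|M| + 1] on [W], while the norm is at most [|M| + 1] on [E]: a cube
   of positive measure disjoint from [E]. A first coordinate exists because [0 < d]. *)
pose W : set 'rV[R]_d := box (const_mx (`|M| + 2)) 1.
have : mu.-negligible W.
  apply: negligibleS phiE => x Wx /= H'; apply: (H x); apply: H' => Ex.
  have := Wx (Ordinal d_gt0); rewrite /= in_itv/= mxE => /andP[Mx _].
  have xM : `|x| <= `|M| + 1.
    by apply: (bM (`|M| + 1)) Ex; rewrite (le_lt_trans (ler_norm M))// ltrDl.
  have := coord_le_norm x (Ordinal d_gt0); have := ler_norm (x ord0 (Ordinal d_gt0)).
  move=> h1 /(le_trans h1) /le_trans /(_ xM); lra.
move/(negligibleP _ (measurable_box _ _)) => /eqP.
rewrite [X in X == _](lebesgue_rV_box _ ltr01) eqe expf_eq0 mulr1 pnatr_eq0 andbF.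
by [].
Qed.

Theorem no_frame_of_translates : False.
Proof.
have [w0 w0P] := frame_transform_neq0.
have [w2 w2P] := transform_has_zero.
have p0 : 0 < N (phi w0).
  rewrite lt_neqAle normc_ge0 andbT eq_sym; apply/eqP => /(@Normc.eq0_normc R).
  exact: w0P.
pose del := N (phi w0) / 2.
have del0 : 0 < del by rewrite divr_gt0.
have [r0 r00 near0] := box_nbhs (near_normc (@cphi w0) del0).
(* The bound A / (2B) together with s <= 1 gives B s^2 <= B s <= A / 2. The bound by 1 also gives
   eps <= del, so that eps / 2 lies below |phi(w0)|. *)
pose s := Num.min 1 (A / (2 * B)).
have s0 : 0 < s by rewrite lt_min ltr01 divr_gt0// mulr_gt0.
have s1 : s <= 1 by rewrite ge_min lexx.
have sA : s * (2 * B) <= A by rewrite -ler_pdivlMr ?mulr_gt0// ge_min lexx orbT.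
pose eps := del * s.
have eps0 : 0 < eps by rewrite mulr_gt0.
(* The midpoint of ]0, eps[: a variation of less than eps / 2 around [w1] keeps |phi| strictly
   inside that interval. *)
have [w1 w1P] : exists w1, N (phi w1) = eps / 2.
  apply: (@normc_IVT _ _ phi w0 w2 _ cphi w2P); apply/andP; split.
    by rewrite divr_ge0// ltW.
  have : eps <= del by rewrite /eps ler_piMr// ltW.
  by rewrite /del; lra.
have eps20 : 0 < eps / 2 by rewrite divr_gt0.
have [r1 r10 near1] := box_nbhs (near_normc (@cphi w1) eps20).
pose r := Num.min r0 r1; have r_gt0 : 0 < r by rewrite lt_min r00 r10.
have lo x : box w0 r x -> del < N (phi x).
  move=> xw; have : N (phi w0 - phi x) < del.
    by apply: near0; apply: box_le xw; rewrite ge_min lexx.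
  have := le_normcD (phi w0 - phi x) (phi x); rewrite subrK /del; lra.
have hi x : box w1 r x -> 0 < N (phi x) < eps.
  move=> xw; have : N (phi w1 - phi x) < eps / 2.
    by apply: near1; apply: box_le xw; rewrite ge_min lexx orbT.
  have := le_normcD (phi w1 - phi x) (phi x); rewrite subrK w1P.
  have := le_normcD (phi x - phi w1) (phi w1); rewrite subrK w1P normcB.
  by move=> ? ? ?; apply/andP; split; lra.
pose v := w1 - w0.
have boxv x : box w1 r (x + v) <-> box w0 r x.
  by rewrite box_shift /v opprB addrCA subrr addr0.
(* The factor 1 gives [g] the shape expected by [box_L1]. *)
pose g w : R[i] := (\1_(box w1 r) w)%:C * 1.
(* Where [phi] is nonzero, [phi w * (q w)%:C] is the inverse of [conjc (phi w)]. Expressing it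
   through [powR] makes the measurability of [k] a matter of composition. *)
pose q w := (N (phi w) ^+ 2) `^ (-1).
pose k w : R[i] := conjc (phi (w + v)) * (phi w * (q w)%:C).
pose F w : R[i] := (\1_(box w0 r) w)%:C * k w.
have mphiv : cmeasurable (fun w => phi (w + v)).
  by apply: (cmfun_comp mphi); exact: measurable_rV_shift.
have mk : cmeasurable k.
  apply: cmfunM; first exact: cmfunJ.
  apply: cmfunM => //; apply: cmfun_real.
  apply: (measurableT_comp (@measurable_powR R (-1))).
  exact: measurable_normc_sqr.
have kphi w : box w0 r w -> k w * conjc (phi w) = conjc (phi (w + v)).
  move=> /lo Nw; rewrite /k /q powR_inv1 ?sqr_ge0// -mulrA mulrAC mulcJ -rmorphM.
  rewrite divff; first by rewrite mulr1.
  by rewrite expf_neq0// gt_eqF// (lt_trans del0).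
have kM w : box w0 r w -> N (k w) <= s.
  move=> wB; have Nw := lo _ wB; have Nw0 : 0 < N (phi w) by exact: lt_trans Nw.
  have -> : N (k w) = N (phi (w + v)) / N (phi w).
    rewrite -(mulfK (lt0r_neq0 Nw0) (N (k w))); congr (_ / _).
    by rewrite -[in LHS](normcJ (phi w)) -Normc.normcM kphi// normcJ.
  rewrite ler_pdivrMr//; have /hi/andP[_ /ltW] := (boxv w).2 wB.
  move=> /le_trans; apply; rewrite /eps mulrC ler_wpM2l//; first exact: ltW.
  exact: ltW.
have [F1 FM Fn] := box_L1 r_gt0 mk kM.
have oneM x : box w1 r x -> N 1 <= 1 by rewrite Normc.normc1.
have [g1 gM _] := box_L1 r_gt0 (cmfun_cst _ _) oneM.
(* [phi] has no zero on the cube and vanishes a.e. off [E], so almost no point of the cube is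
   outside [E]. *)
have gE : {ae mu, forall w, ~ E w -> g w = 0}.
  apply: filterS phiE => w Hw Ew; rewrite /g indicE memNset ?mul0r// => /hi.
  by rewrite Hw// Normc.normc0 ltxx.
have FE : {ae mu, forall w, ~ E w -> F w = 0}.
  apply: filterS phiE => w Hw Ew; rewrite /F indicE memNset ?mul0r// => /lo.
  by rewrite Hw// Normc.normc0 => /(lt_trans del0); rewrite ltxx.
have gn : sqnormL2 g = ((2 * r) ^+ d)%:E.
  transitivity (\int[mu]_x (\1_(box w1 r) x)%:E)%E.
    apply: eq_integral => x _; rewrite /g mulr1 normcR indicE.
    by case: (x \in box w1 r); rewrite ?normr1 ?normr0 ?expr1n ?expr0n.
  rewrite integral_indic//; last exact: measurable_box.
  by rewrite setIT; exact: lebesgue_rV_box.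
have SFg : S F = S g.
  apply: eq_esum => j _; congr EFin; rewrite /coef; congr (_ ^+ 2).
  set a := lam j.
  (* The integrand for [g] with the constant phase of the translation put in front; its value at w +
     v is the integrand for [F] at w. *)
  pose H w : R[i] := expi (- (2 * pi * dotp v a)) *
     (g w * expi (2 * pi * dotp w a) * conjc (phi w)).
  have mH : cmeasurable H.
    apply: cmfunM; first exact: cmfun_cst.
    apply: cmfunM; last exact: cmfunJ.
    apply: cmfunM; first by case: g1.
    exact: cmfun_expi_dotpl.
  have -> : innerL2 (fun w => F w * expi (2 * pi * dotp w a)) phi = cintegral H.
    rewrite -(cintegral_shift v mH); apply: eq_cint => w.
    rewrite /H /F /g mulr1 (dotpDl w v) [in RHS](mulrDr (2 * pi)) [in RHS]expiD.
    have [wB|wB] := pselect (box w0 r w); last first.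
      rewrite !indicE !memNset// ?mul0r ?mulr0//.
      by move=> /boxv.
    rewrite !indicE !mem_set//; last exact/boxv.
    rewrite !mul1r mulrAC kphi// mulrC; rewrite [RHS]mulrA; congr (_ * _).
    rewrite [RHS]mulrCA -expiD addNr.
    by rewrite /expi cos0 sin0 mulr1.
  have ge1 : L1 (fun w => g w * expi (2 * pi * dotp w a)) by exact: L1_expi_dotpl.
  have ge2 : L2 (fun w => g w * expi (2 * pi * dotp w a)).
    by apply: (L2_bounded (M := `|1|) ge1) => x; rewrite Normc.normcM normc_expi mulr1;
        exact: gM.
  have [gphi1 _] := innerL2_bound ltr01 ge2 phi2.
  by rewrite [cintegral H]cintZ// Normc.normcM normc_expi mul1r.
have /andP[gA _] := frame_phi g1 gM gE.
have /andP[_ FB] := frame_phi F1 FM FE.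
rewrite SFg in FB.
have : (A%:E * sqnormL2 g <= (B * (s ^+ 2 * (2 * r) ^+ d))%:E)%E.
  by apply: (le_trans gA); apply: (le_trans FB); rewrite EFinM lee_pmul2l ?lte_fin.
rewrite gn -EFinM lee_fin mulrA ler_pM2r; last by rewrite exprn_gt0// mulr_gt0.
have : B * s ^+ 2 <= B * s by rewrite ler_pM2l// expr2 ler_piMr// ltW.
move=> Bs /le_trans/(_ Bs)/(le_trans sA).
by rewrite mulrCA [s * B]mulrC mulr_natl mulr2n gerDl leNgt mulr_gt0.
Qed.

End frame_main.

End frame.

Theorem corollary4p2 (R : realType) (d : nat) (d_gt0 : (0 < d)%N)
    (E : set 'rV[R]_d) (mE : lebesgue_measurable E) (bE : bounded_set E)
    (E_nonnull : ~ (lebesgue_rV d).-negligible E)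
    (h : 'rV[R]_d -> R[i]) (hE : paley_wiener E h)
    (hc : exists hhat : 'rV[R]_d -> R[i],
        is_fourierL2 h hhat /\ continuous (hhat : 'rV[R]_d -> R[i]^o)) :
  ~ exists (K : countType) (lambda : K -> 'rV[R]_d),
      is_frame (paley_wiener E) (fun k => translate (lambda k) h).
Proof.
move=> [K [lam fr]].
have [phi [hphi cphi]] := hc.
have [psi [hpsi psi0]] := hE.
have [A [B [A0 B0 FR]]] := paley_wiener_frame hphi fr.
have [_ phi2 _] := hphi.
(* [psi] is the representative known to vanish off [E]; the property passes to the continuous
   one. *)
have phiE : {ae lebesgue_rV d, forall w, ~ E w -> phi w = 0}.
  by apply: filterS2 (is_fourierL2_ae_unique hphi hpsi) psi0 => w ->.
exact: (no_frame_of_translates d_gt0 mE bE E_nonnull cphi phi2 phiE A0 B0 FR).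
Qed.
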